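(* Let $k$ be a field of characteristic zero, let $q\in k$, $q\neq0$, and let $W_q=k\{x,y\}/(xy-qyx-1)$. If $q$ is not an $N$th root of unity for any $N$, then $H^0(W_q)=k$, $H^1(W_q)$ is one-dimensional over $k$ and generated by the class of the derivation $x\partial_x-y\partial_y$, and $H^2(W_q)$ is one-dimensional over $k$ and generated by the class of a 2-cocycle $w_q$ which is a lift of the 2-cocycle $x\partial_x\wedge y\partial_y$ of $W_{\mathrm{qp}}=k\{x,y\}/(xy-qyx)$.
   Context: $H^n(A)=H^n(A,A)$ denotes Hochschild cohomology of an algebra $A$ with coefficients in itself; $k\{x,y\}$ is the free associative algebra. On $W_{\mathrm{qp}}$, $x\partial_x$ is the derivation with $x\mapsto x,\ y\mapsto0$, and $y\partial_y$ the derivation with $x\mapsto0,\ y\mapsto y$. For derivations $D_1,D_2$, $D_1\wedge D_2=\tfrac12(D_1\smile D_2-D_2\smile D_1)$, where $(D_1\smile D_2)(a,b)=D_1(a)D_2(b)$. On $W_q$, $x\partial_x-y\partial_y$ denotes the derivation with $x\mapsto x,\ y\mapsto-y$. $W_q(\hbar)=k[\hbar]\{x,y\}/(xy-qyx-\hbar)$ is a deformation of $W_{\mathrm{qp}}$: using the basis $x^iy^j$ ($i,j\ge 0$) it is identified as a module with $W_{\mathrm{qp}}[\hbar]$, with multiplication of the form $a*b=ab+\hbar m_1(a,b)+\hbar^2m_2(a,b)+\cdots$, a finite sum for each $a,b\in W_{\mathrm{qp}}$. Setting $\hbar=1$ gives $W_q$. A lift of a Hochschild $n$-cocycle $z$ of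 $W_{\mathrm{qp}}$ to $W_q(\hbar)$ is an $n$-cocycle $z_{\hbar}=z+\hbar z_1+\hbar^2z_2+\cdots$ for the deformed multiplication, with $z_i$ $n$-cochains of $W_{\mathrm{qp}}$ extended multilinearly. A lift of $z$ to $W_q$ is obtained by setting $\hbar=1$ in such a $z_{\hbar}$ for which the series $z_{\hbar}(a_1,\dots,a_n)$ is a finite sum for all $a_1,\dots,a_n\in W_{\mathrm{qp}}$. *)

(* Defs.v *)
From HB Require Import structures.
From mathcomp Require Import all_boot all_algebra.
From mathcomp Require Import boolp functions.
From mathcomp Require Import finmap monalg ring.

Set Implicit Arguments.
Unset Strict Implicit.
Unset Printing Implicit Defensive.

Import GRing.Theory.

Local Open Scope ring_scope.
Local Open Scope quotient_scope.

Section LmodQuotient.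
Variables (R : pzRingType) (V : lmodType R) (S : submodClosed V).

Definition submod_pred : {pred V} := S.
HB.instance Definition _ := GRing.isZmodClosed.Build V submod_pred
  (GRing.submod_closedB (submodClosedP S)).

Definition lquot : Type := Quotient.quot submod_pred.
HB.instance Definition _ := EqQuotient.on lquot.
HB.instance Definition _ := GRing.Zmodule.on lquot.

Definition lquot_scale (c : R) (u : lquot) : lquot := \pi_lquot (c *: repr u).

Lemma lquot_eqP (u v : V) :
  reflect (\pi_lquot u = \pi_lquot v) (u - v \in S).
Proof. by rewrite (Quotient.idealrBE submod_pred); exact: eqP. Qed.

Lemma lquotD (u v : V) : \pi_lquot (u + v) = \pi_lquot u + \pi_lquot v.
Proof. exact: (Quotient.pi_add submod_pred). Qed.

Lemma lquot_scaleE c (u : V) :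
  lquot_scale c (\pi_lquot u) = \pi_lquot (c *: u).
Proof.
apply/lquot_eqP; rewrite -scalerBr rpredZ //.
by apply/lquot_eqP; rewrite reprK.
Qed.

Fact lquot_scaleA c d (u : lquot) :
  lquot_scale c (lquot_scale d u) = lquot_scale (c * d) u.
Proof. by elim/quotW: u => u; rewrite (lquot_scaleE d u) !lquot_scaleE scalerA. Qed.

Fact lquot_scale1 : left_id 1 lquot_scale.
Proof. by elim/quotW => u; rewrite lquot_scaleE scale1r. Qed.

Fact lquot_scaleDr : right_distributive lquot_scale +%R.
Proof.
move=> c; elim/quotW => u; elim/quotW => v.
by rewrite -lquotD !lquot_scaleE scalerDr lquotD.
Qed.

Fact lquot_scaleDl (u : lquot) :
  {morph lquot_scale^~ u : a b / a + b >-> a + b}.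
Proof.
by move=> c d; elim/quotW: u => u; rewrite !lquot_scaleE scalerDl lquotD.
Qed.

HB.instance Definition _ := GRing.Zmodule_isLmodule.Build R lquot
  lquot_scaleA lquot_scale1 lquot_scaleDr lquot_scaleDl.

Lemma lquotZ c (u : V) : \pi_lquot (c *: u) = c *: \pi_lquot u.
Proof. by rewrite -lquot_scaleE. Qed.

End LmodQuotient.

Section TwoSidedIdeal.
Variables (R : pzRingType) (F : lalgType R) (r : F).

Definition tsideal : {pred F} := fun u : F =>
  `[< exists s : seq (F * F), u = \sum_(p <- s) p.1 * r * p.2 >].

Lemma tsidealP (u : F) :
  reflect (exists s : seq (F * F), u = \sum_(p <- s) p.1 * r * p.2)
          (u \in tsideal).
Proof. exact: asboolP. Qed.

Lemma tsideal_rel : r \in tsideal.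
Proof. by apply/tsidealP; exists [:: (1, 1)]; rewrite big_seq1 mul1r mulr1. Qed.

Lemma tsidealMl a u : u \in tsideal -> a * u \in tsideal.
Proof.
move=> /tsidealP[s ->]; apply/tsidealP.
exists [seq (a * p.1, p.2) | p <- s]; rewrite big_map mulr_sumr.
by apply: eq_bigr => p _ /=; rewrite !mulrA.
Qed.

Lemma tsidealMr a u : u \in tsideal -> u * a \in tsideal.
Proof.
move=> /tsidealP[s ->]; apply/tsidealP.
exists [seq (p.1, p.2 * a) | p <- s]; rewrite big_map mulr_suml.
by apply: eq_bigr => p _ /=; rewrite !mulrA.
Qed.

Lemma tsideal_add : addr_closed tsideal.
Proof.
split; first by apply/tsidealP; exists [::]; rewrite big_nil.
move=> u v /tsidealP[s ->] /tsidealP[t ->]; apply/tsidealP.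
by exists (s ++ t); rewrite big_cat.
Qed.

Lemma tsideal_scale : scaler_closed tsideal.
Proof. by move=> c u uI; rewrite -[u]mul1r scalerAl tsidealMl. Qed.

HB.instance Definition _ := GRing.isAddClosed.Build F tsideal tsideal_add.
HB.instance Definition _ := GRing.isScaleClosed.Build R F tsideal tsideal_scale.

End TwoSidedIdeal.

(* The free associative algebra R{x,y}: words in the letters false (for x) and
   true (for y). *)
Notation freealg2 R := {malg R[{fmonom bool}]}.

Section FreeAlgebra.
Variable (R : comNzRingType).

Definition fgen (b : bool) : freealg2 R := << fmu b >>.

Lemma freealg2_scalerAr (c : R) (u v : freealg2 R) :
  c *: (u * v) = u * (c *: v).
Proof.
apply/malgP => k; rewrite mcoeffZ mcoeffMl.
rewrite (mcoeffMlw k (fsubset_refl (msupp u)) (msuppZ_le c v)).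
rewrite mulr_sumr; apply: eq_bigr => i _; rewrite mulr_sumr.
apply: eq_bigr => j _; rewrite mcoeffZ mulrnAr; congr (_ *+ _).
by rewrite !mulrA [c * _]mulrC.
Qed.

End FreeAlgebra.

Lemma mulr_suml3 (A : pzRingType) (I J : Type) (s : seq I) (t : seq J)
    (f : I -> A) (g : J -> A) (c : A) :
  (\sum_(i <- s) f i) * c * (\sum_(j <- t) g j) =
  \sum_(i <- s) \sum_(j <- t) f i * c * g j.
Proof.
by rewrite !mulr_suml; apply: eq_bigr => i _; rewrite mulr_sumr.
Qed.

Section WeylRing.
Variables (R : comNzRingType) (q r : R).
Local Notation F := (freealg2 R).

(* weyl q r = R{x,y} / (xy - q yx - r) *)
Definition weyl_rel : F :=
  fgen R false * fgen R true - q *: (fgen R true * fgen R false) - r%:A.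

Definition weyl : Type := lquot (tsideal weyl_rel).
HB.instance Definition _ := EqQuotient.on weyl.
HB.instance Definition _ := GRing.Lmodule.on weyl.

Definition weyl_pi (u : F) : weyl := \pi_weyl u.

Lemma weyl_piP (u v : F) :
  reflect (weyl_pi u = weyl_pi v) (u - v \in tsideal weyl_rel).
Proof. exact: lquot_eqP. Qed.

Lemma weyl_ind (P : weyl -> Prop) : (forall u, P (weyl_pi u)) -> forall u, P u.
Proof. by move=> Pu u; rewrite -[u]reprK; exact: Pu. Qed.

Lemma weyl_reprK : cancel repr weyl_pi.
Proof. exact: reprK. Qed.

Lemma weyl_piD u v : weyl_pi (u + v) = weyl_pi u + weyl_pi v.
Proof. exact: lquotD. Qed.

Lemma weyl_piZ c u : weyl_pi (c *: u) = c *: weyl_pi u.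
Proof. exact: lquotZ. Qed.

(* A representation on sequences (y shifts, x is a q-difference operator)
   shows that 1 does not lie in the ideal. *)
Fixpoint qnat (n : nat) : R := if n is m.+1 then 1 + q * qnat m else 0.

Definition act1 (b : bool) (f : nat -> R) : nat -> R :=
  if b then fun i => if i is j.+1 then f j else 0
  else fun i => r * qnat i.+1 * f i.+1.

Definition act (m : {fmonom bool}) (f : nat -> R) : nat -> R := foldr act1 f m.

Definition rho (f : nat -> R) (i : nat) (u : F) : R :=
  mmap idfun (fun m => act m f i) u.

Lemma actM m1 m2 f : act (fmmul m1 m2) f = act m1 (act m2 f).
Proof. by rewrite /act /fmmul fmE /= foldr_cat. Qed.

Lemma actU b f : act (fmu b) f = act1 b f.
Proof. by rewrite /act /fmu fmE. Qed.

Lemma act0 f : act (fmone _) f = f.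
Proof. by rewrite /act /fmone fmE. Qed.

Lemma act_rel f i :
  act1 false (act1 true f) i - q * act1 true (act1 false f) i - r * f i = 0.
Proof. by case: i => [|i] /=; ring. Qed.

Lemma act_comb m (g h l : nat -> R) :
  (forall i, g i - q * h i - r * l i = 0) ->
  forall i, act m g i - q * act m h i - r * act m l i = 0.
Proof.
rewrite /act => ghl; elim: (fmonom_val m) => [|b s IHs] //= i.
case: b => /=; first by case: i => [|i] //; rewrite !mulr0 !subr0.
transitivity (r * (1 + q * qnat i) * (foldr act1 g s i.+1
  - q * foldr act1 h s i.+1 - r * foldr act1 l s i.+1)); first by ring.
by rewrite IHs mulr0.
Qed.

Lemma rhoU f i c m : rho f i << c *g m >> = c * act m f i.
Proof. exact: mmapU. Qed.

Lemma malgUU c d m n : << c *g m >> * << d *g n >> = << c * d *g fmmul m n >> :> F.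
Proof. exact: fgmulUU. Qed.

Lemma weyl_relE : weyl_rel = << 1 *g fmmul (fmu false) (fmu true) >>
  - << q *g fmmul (fmu true) (fmu false) >> - << r *g fmone _ >>.
Proof.
have scaleU c m : c *: << 1 *g m >> = << c *g m >> :> F.
  by apply/malgP => k; rewrite mcoeffZ !mcoeffU mulrnAr mulr1.
by rewrite /weyl_rel /fgen !malgUU mulr1 scaleU -[X in _ *: X]/(<< 1 *g fmone _ >>) scaleU.
Qed.

Lemma rho_tsideal f i u : u \in tsideal weyl_rel -> rho f i u = 0.
Proof.
move=> /tsidealP[s ->]; rewrite /rho raddf_sum big1 // => -[a b] _ /=.
rewrite (_ : a * weyl_rel * b = \sum_(m <- msupp a) \sum_(n <- msupp b)
  << a@_m *g m >> * weyl_rel * << b@_n *g n >>); last first.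
  by rewrite {1}(monalgE a) {1}(monalgE b); exact: mulr_suml3.
rewrite raddf_sum big1 // => m _; rewrite raddf_sum big1 // => n _.
rewrite weyl_relE !mulrBr !mulrBl !malgUU !raddfB /= !mmapU !actM !actU act0 /=.
have := act_comb m (fun j => act_rel (act n f) j) i.
set A := act m _ i; set B := act m _ i; set C := act m _ i => e.
transitivity (a@_m * b@_n * (A - q * B - r * C)); first by ring.
by rewrite e mulr0.
Qed.

Fact weyl_rel_proper : 1 \notin tsideal weyl_rel.
Proof.
apply/negP => /(@rho_tsideal (fun=> 1) 0) /eqP.
by rewrite -[X in rho _ _ X]/(<< 1 *g fmone _ >>) rhoU mul1r act0 oner_eq0.
Qed.

Definition weyl_mul (u v : weyl) : weyl := weyl_pi (repr u * repr v).

Fact weyl_mulE u v : weyl_mul (weyl_pi u) (weyl_pi v) = weyl_pi (u * v).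
Proof.
apply/weyl_piP; set u' := repr _; set v' := repr _.
have Iu : u' - u \in tsideal weyl_rel by apply/weyl_piP; rewrite weyl_reprK.
have Iv : v' - v \in tsideal weyl_rel by apply/weyl_piP; rewrite weyl_reprK.
have -> : u' * v' - u * v = u' * (v' - v) + (u' - u) * v.
  by rewrite mulrBr mulrBl addrA subrK.
by apply: rpredD; [exact: tsidealMl | exact: tsidealMr].
Qed.

Definition weyl_one : weyl := weyl_pi 1.

Fact weyl_mulA : associative weyl_mul.
Proof.
elim/weyl_ind => u; elim/weyl_ind => v; elim/weyl_ind => w.
by rewrite (weyl_mulE u v) (weyl_mulE v w) !weyl_mulE mulrA.
Qed.

Fact weyl_mul1 : left_id weyl_one weyl_mul.
Proof. by elim/weyl_ind => u; rewrite weyl_mulE mul1r. Qed.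

Fact weyl_mulr1 : right_id weyl_one weyl_mul.
Proof. by elim/weyl_ind => u; rewrite weyl_mulE mulr1. Qed.

Fact weyl_mulDl : left_distributive weyl_mul +%R.
Proof.
elim/weyl_ind => u; elim/weyl_ind => v; elim/weyl_ind => w.
by rewrite -weyl_piD !weyl_mulE mulrDl weyl_piD.
Qed.

Fact weyl_mulDr : right_distributive weyl_mul +%R.
Proof.
elim/weyl_ind => u; elim/weyl_ind => v; elim/weyl_ind => w.
by rewrite -weyl_piD !weyl_mulE mulrDr weyl_piD.
Qed.

Fact weyl_1neq0 : weyl_one != 0.
Proof.
have pi0 : weyl_pi 0 = 0 by rewrite -(scale0r 0) weyl_piZ scale0r.
rewrite -pi0; apply: contraNneq weyl_rel_proper => e.
by rewrite -[1]subr0; apply/weyl_piP.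
Qed.

HB.instance Definition _ := GRing.Zmodule_isNzRing.Build weyl
  weyl_mulA weyl_mul1 weyl_mulr1 weyl_mulDl weyl_mulDr weyl_1neq0.

Lemma weyl_piM u v : weyl_pi (u * v) = weyl_pi u * weyl_pi v.
Proof. by rewrite -weyl_mulE. Qed.

Lemma weyl_pi1 : weyl_pi 1 = 1.
Proof. by []. Qed.

Fact weyl_scalerAl (c : R) (u v : weyl) : c *: (u * v) = c *: u * v.
Proof.
elim/weyl_ind: u => u; elim/weyl_ind: v => v.
by rewrite -weyl_piM -!weyl_piZ -weyl_piM scalerAl.
Qed.

HB.instance Definition _ := GRing.Lmodule_isLalgebra.Build R weyl weyl_scalerAl.

Fact weyl_scalerAr (c : R) (u v : weyl) : c *: (u * v) = u * (c *: v).
Proof.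
elim/weyl_ind: u => u; elim/weyl_ind: v => v.
by rewrite -weyl_piM -!weyl_piZ -weyl_piM freealg2_scalerAr.
Qed.

HB.instance Definition _ := GRing.Lalgebra_isAlgebra.Build R weyl weyl_scalerAr.

Definition weyl_x : weyl := weyl_pi (fgen R false).
Definition weyl_y : weyl := weyl_pi (fgen R true).

Lemma weyl_xy : weyl_x * weyl_y = q *: (weyl_y * weyl_x) + r%:A.
Proof.
rewrite -!weyl_piM -weyl_piZ -weyl_pi1 -weyl_piZ -weyl_piD; apply/weyl_piP.
by rewrite opprD addrA; exact: tsideal_rel.
Qed.

End WeylRing.

Section Hochschild.
Variables (R : comNzRingType) (A : algType R).

Definition set_arg n (a : {ffun 'I_n -> A}) (i : 'I_n) (u : A) :
  {ffun 'I_n -> A} := [ffun j => if j == i then u else a j].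

Definition multilinear n (f : {ffun 'I_n -> A} -> A) : Prop :=
  forall (a : {ffun 'I_n -> A}) (i : 'I_n) (c : R) (u v : A),
    f (set_arg a i (c *: u + v)) = c *: f (set_arg a i u) + f (set_arg a i v).

(* (a_0, ..., a_n) |-> (a_0, ..., a_i a_{i+1}, ..., a_n) *)
Definition contract n (i : 'I_n) (a : {ffun 'I_n.+1 -> A}) :
  {ffun 'I_n -> A} :=
  [ffun j : 'I_n => if (j < i)%N then a (lift ord_max j)
             else if j == i then a (lift ord_max j) * a (lift ord0 j)
             else a (lift ord0 j)].

Definition hdiff n (f : {ffun 'I_n -> A} -> A) (a : {ffun 'I_n.+1 -> A}) : A :=
  a ord0 * f [ffun j => a (lift ord0 j)]
  + \sum_(i < n) (-1) ^+ i.+1 *: f (contract i a)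
  + (-1) ^+ n.+1 *: (f [ffun j => a (lift ord_max j)] * a ord_max).

Lemma hdiffP n c (f g : {ffun 'I_n -> A} -> A) a :
  hdiff (c *: f + g) a = c *: hdiff f a + hdiff g a.
Proof.
have E b : (c *: f + g) b = c *: f b + g b by [].
rewrite /hdiff !E mulrDr mulrDl.
under eq_bigr => i _ do rewrite E scalerDr scalerA mulrC -scalerA.
rewrite big_split -scaler_sumr /= !scalerDr -!scalerAl -!scalerAr !scalerA.
by rewrite [_ ^+ _ * c]mulrC [X in X + _ = _]addrACA [LHS]addrACA.
Qed.

Lemma hdiff0 n a : hdiff (0 : {ffun 'I_n -> A} -> A) a = 0.
Proof. by have := hdiffP (-1) 0 0 a; rewrite scaler0 addr0 scaleN1r addNr. Qed.

Section Degree.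
Variable n : nat.

Definition is_hcocycle : {pred {ffun 'I_n -> A} -> A} :=
  fun f => `[< multilinear f /\ hdiff f = 0 >].

Fact is_hcocycle_submod : submod_closed is_hcocycle.
Proof.
split=> [|c f g /asboolP[fm df] /asboolP[gm dg]]; apply/asboolP; split.
- by move=> a i c u v; rewrite /= scaler0 addr0.
- by apply/funext => a; rewrite hdiff0.
- have E b : (c *: f + g) b = c *: f b + g b by [].
  move=> a i d u v; rewrite !E fm gm !scalerDr !scalerA.
  by rewrite [c * d]mulrC [LHS]addrACA.
- by apply/funext => a; rewrite hdiffP df dg scaler0 addr0.
Qed.
HB.instance Definition _ := GRing.isSubmodClosed.Build R _ is_hcocycle
  is_hcocycle_submod.

(* Z^n(A, A) *)
Record hcocycle := HCocycle {
  hcocycle_val :> {ffun 'I_n -> A} -> A;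
  _ : hcocycle_val \in is_hcocycle }.
HB.instance Definition _ := [isSub for hcocycle_val].
HB.instance Definition _ := [Choice of hcocycle by <:].
HB.instance Definition _ := [SubChoice_isSubLmodule of hcocycle by <:].

End Degree.

(* B^n(A, A) *)
Definition is_hcoboundary n : {pred hcocycle n} :=
  match n with
  | 0 => fun z : hcocycle 0 => z == 0
  | m.+1 => fun z : hcocycle m.+1 =>
      `[< exists2 g : {ffun 'I_m -> A} -> A,
            multilinear g & hcocycle_val z = hdiff g >]
  end.

Fact is_hcoboundary_submod n : submod_closed (@is_hcoboundary n).
Proof.
case: n => [|n]; first by split=> [|c z w /eqP-> /eqP->]; rewrite /in_mem /= ?scaler0 ?addr0.
split=> [|c z w /asboolP[g gm zg] /asboolP[h hm wh]]; apply/asboolP.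
  exists 0; first by move=> a i c u v; rewrite /= scaler0 addr0.
  by apply/funext => a; rewrite hdiff0.
exists (c *: g + h).
  have E b : (c *: g + h) b = c *: g b + h b by [].
  move=> a i d u v; rewrite !E gm hm !scalerDr !scalerA.
  by rewrite [c * d]mulrC [LHS]addrACA.
have -> : hcocycle_val (c *: z + w) = c *: hcocycle_val z + hcocycle_val w by [].
by apply/funext => a; rewrite hdiffP zg wh.
Qed.
HB.instance Definition _ n := GRing.isSubmodClosed.Build R _ (@is_hcoboundary n)
  (@is_hcoboundary_submod n).

Definition HH n : Type := lquot (@is_hcoboundary n).
HB.instance Definition _ n := EqQuotient.on (HH n).
HB.instance Definition _ n := GRing.Lmodule.on (HH n).

Definition HH_class n (z : hcocycle n) : HH n := \pi_(HH n) z.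

Lemma HH_classP n c (z w : hcocycle n) :
  HH_class (c *: z + w) = c *: HH_class z + HH_class w.
Proof. by rewrite /HH_class -lquotZ -lquotD. Qed.

Lemma HH_class0 n : HH_class (0 : hcocycle n) = 0.
Proof. by have := HH_classP (-1) (0 : hcocycle n) 0; rewrite scaler0 addr0 scaleN1r addNr. Qed.

Lemma HH_class_eq0 n (z : hcocycle n) :
  HH_class z = 0 <-> z \in @is_hcoboundary n.
Proof.
rewrite -HH_class0 -[in X in _ <-> X](subr0 z); split => h.
  exact/(lquot_eqP (@is_hcoboundary n)).
exact/(lquot_eqP (@is_hcoboundary n)).
Qed.

End Hochschild.

(* H^n(A, A) is the line spanned by the class of f. *)
Definition HH_line (R : comNzRingType) (A : algType R) n
    (f : {ffun 'I_n -> A} -> A) : Prop :=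
  exists z : hcocycle A n,
    [/\ hcocycle_val z = f, HH_class z != 0
      & forall h : HH A n, exists c : R, h = c *: HH_class z].

Section Derivations.
Variables (k : fieldType) (A : algType k).

Definition derivation (D : A -> A) : Prop :=
  (forall (c : k) (u v : A), D (c *: u + v) = c *: D u + D v) /\
  (forall u v : A, D (u * v) = D u * v + u * D v).

Definition cochain1 (D : A -> A) (a : {ffun 'I_1 -> A}) : A := D (a ord0).

Definition cup (D1 D2 : A -> A) (a : {ffun 'I_2 -> A}) : A :=
  D1 (a ord0) * D2 (a ord_max).

Definition wedge (D1 D2 : A -> A) : {ffun 'I_2 -> A} -> A :=
  2%:R^-1 *: (cup D1 D2 - cup D2 D1).

End Derivations.

(* The identification of module structures through the bases x^i y^j, along a
   change of scalars iota; there is at most one such sigma, because the x^i y^j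
   span weyl q 0 when q is a unit. *)
Definition normal_ordering (R S : comNzRingType) (iota : R -> S)
    (q : R) (q' s : S) (sigma : weyl q 0 -> weyl q' s) : Prop :=
  [/\ forall u v, sigma (u + v) = sigma u + sigma v,
      forall c u, sigma (c *: u) = iota c *: sigma u
    & forall i j : nat, sigma (weyl_x q 0 ^+ i * weyl_y q 0 ^+ j) =
                        weyl_x q' s ^+ i * weyl_y q' s ^+ j].

(* With W_qp = weyl q 0, W_q = weyl q 1 and W_q(h) = weyl q%:P 'X over k[h],
   h being 'X.  The cochain z_h = \sum_i h^i z_i on W_qp[h] is carried to the
   k[h]-algebra W_q(h) by sigma_h, and its value at h = 1 to W_q by sigma_1; a
   k[h]-multilinear cochain of W_q(h) is determined by its values on the image
   of sigma_h. *)
Definition is_lift (k : fieldType) (q : k) n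
    (z : hcocycle (weyl q 0) n) (w : hcocycle (weyl q 1) n) : Prop :=
  exists (sigma_h : weyl q 0 -> weyl (q%:P : {poly k}) 'X)
         (sigma_1 : weyl q 0 -> weyl q 1)
         (zs : nat -> {ffun 'I_n -> weyl q 0} -> weyl q 0)
         (z_h : hcocycle (weyl (q%:P : {poly k}) 'X) n),
    [/\ normal_ordering polyC sigma_h /\ normal_ordering id sigma_1,
        forall i, multilinear (zs i),
        zs 0 = hcocycle_val z
      & forall a : {ffun 'I_n -> weyl q 0}, exists N : nat,
          [/\ forall i, (N <= i)%N -> zs i a = 0,
              z_h [ffun j => sigma_h (a j)]
                = \sum_(i < N) 'X^i *: sigma_h (zs i a)
            & w [ffun j => sigma_1 (a j)] = \sum_(i < N) sigma_1 (zs i a)]].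

(* Main.v *)
(* A 2-cocycle f of A = W_q defines a square-zero extension of A in which
   xy - qyx - 1 takes the value f(x,y) - q f(y,x) + f(1,1), and f is a
   coboundary exactly when this obstruction lies in the image of
   d(a,b) = ay + xb - q(bx + ya), because then the generators lift to the
   extension with their relation.  In the basis y^i x^j the cokernel of d is the
   line spanned by yx: a linear form supported on the diagonal monomials kills
   the image of d but not yx.  Likewise derivations correspond to the kernel of
   d, and normalizing them modulo inner derivations leaves x d/dx - y d/dy.

   The generator of H^2 is q times the derivative with respect to q of the
   structure constants in the basis y^i x^j, antisymmetrized by a coboundary.
   The construction is natural in the ground ring; at r = 0 it gives the wedge
   of the two Euler derivations, and over k[h] with r = h it provides the
   lift. *)
Require Import Defs.
From mathcomp Require Import all_boot all_algebra.
From mathcomp Require Import boolp functions.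
From mathcomp Require Import finmap monalg ring zify.

Import GRing.Theory.
Local Open Scope ring_scope.

Set Implicit Arguments.
Unset Strict Implicit.
Unset Printing Implicit Defensive.

(** * Linear identities in modules *)

Section LinearExpressions.
Variables (R : pzRingType) (V : lmodType R).

Inductive lexp :=
  | LVar of nat | LAdd of lexp & lexp | LOpp of lexp | LScale of R & lexp | LZero.

Fixpoint leval (env : seq V) (e : lexp) : V :=
  match e with
  | LVar n => nth 0 env n
  | LAdd e f => leval env e + leval env f
  | LOpp e => - leval env e
  | LScale c e => c *: leval env e
  | LZero => 0
  end.

Fixpoint lcoef (e : lexp) (n : nat) : R :=
  match e with
  | LVar m => if Nat.eqb m n then 1 else 0
  | LAdd e f => lcoef e n + lcoef f n
  | LOpp e => - lcoef e n
  | LScale c e => c * lcoef e n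
  | LZero => 0
  end.

Fixpoint lcoef_eq (e f : lexp) (n : nat) : Prop :=
  if n is m.+1 then lcoef e m = lcoef f m /\ lcoef_eq e f m else True.

Lemma leval_coef env e :
  leval env e = \sum_(i < size env) lcoef e i *: nth 0 env i.
Proof.
elim: e => /= [n|e -> f ->|e ->|c e ->|].
- have eqbE i : Nat.eqb n i = (i == n) by elim: n i => [|n IHn] [|i] //=; rewrite IHn.
  case: (ltnP n (size env)) => h.
    rewrite (bigD1 (Ordinal h)) //= eqbE eqxx scale1r [X in _ + X]big1 ?addr0 // => i.
    by rewrite eqbE => /negPf /= E; rewrite -val_eqE /= in E; rewrite E scale0r.
  rewrite nth_default // big1 // => i _; rewrite eqbE.
  by rewrite (_ : (i == n :> nat) = false) ?scale0r // ltn_eqF // (leq_trans _ h).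
- by rewrite -big_split; apply: eq_bigr => i _; rewrite scalerDl.
- by rewrite -sumrN; apply: eq_bigr => i _; rewrite scaleNr.
- by rewrite scaler_sumr; apply: eq_bigr => i _; rewrite scalerA.
- by rewrite big1 // => i _; rewrite scale0r.
Qed.

Lemma leval_eq env e f : lcoef_eq e f (size env) -> leval env e = leval env f.
Proof.
move=> ef; rewrite !leval_coef; apply: eq_bigr => i _; congr (_ *: _).
elim: (size env) ef i => [_ []//|n IHn /= [en efn] i].
by case: (ltngtP i n) (ltn_ord i) => [h _|h|->//]; [exact: IHn efn (Ordinal h) | lia].
Qed.

End LinearExpressions.

(* lmod R V proves an identity between R-linear combinations in V by comparing
   the coefficients of the atoms; hypotheses are fed to it through lc_use, which
   subtracts a linear combination of them from the goal. *)
Ltac lmod_index v env :=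
  lazymatch env with
  | ?w :: ?env' =>
      match constr:(Set) with
      | _ => let _ := match constr:(Set) with _ => unify v w end in constr:(O)
      | _ => let n := lmod_index v env' in constr:(S n)
      end
  end.
Ltac lmod_env t env :=
  lazymatch t with
  | Algebra.add ?a ?b => let env' := lmod_env a env in lmod_env b env'
  | Algebra.opp ?a => lmod_env a env
  | GRing.scale _ ?a => lmod_env a env
  | @Algebra.zero _ => env
  | _ => match constr:(Set) with
         | _ => let n := lmod_index t env in env
         | _ => constr:(t :: env)
         end
  end.
Ltac lmod_reify R t env :=
  lazymatch t with
  | Algebra.add ?a ?b =>
      let e := lmod_reify R a env in let f := lmod_reify R b env in
      constr:(LAdd e f)
  | Algebra.opp ?a => let e := lmod_reify R a env in constr:(LOpp e)
  | GRing.scale ?c ?a =>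
      let e := lmod_reify R a env in constr:(@LScale R c e)
  | @Algebra.zero _ => constr:(@LZero R)
  | _ => let n := lmod_index t env in constr:(@LVar R n)
  end.
Ltac lmod R V :=
  lazymatch goal with |- ?l = ?r =>
    let env := lmod_env l (@nil V) in
    let env := lmod_env r env in
    let e := lmod_reify R l env in
    let f := lmod_reify R r env in
    change (@leval R V env e = @leval R V env f);
    apply: leval_eq; cbn [size lcoef_eq lcoef Nat.eqb];
    repeat match goal with |- _ /\ _ => split end; try exact I; try ring
  end.

Ltac alg_expand :=
  rewrite ?(mulrDl, mulrDr, mulrBl, mulrBr, mulNr, mulrN, scalerDr, scalerBr, mulr0, mul0r);
  rewrite -?(scalerAl, scalerAr) ?(mulr1, mul1r) ?mulrA.


Section LinearCombination.
Variables (Z : zmodType) (R : pzRingType) (V : lmodType R).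

Lemma lc_use (z u v : Z) : z = 0 -> u - v = z -> u = v.
Proof. by move=> -> /subr0_eq. Qed.

Lemma lc_eq (u v : Z) : u = v -> u - v = 0.
Proof. by move=> ->; rewrite subrr. Qed.

Lemma lc_add (u v : Z) : u = 0 -> v = 0 -> u + v = 0.
Proof. by move=> -> ->; rewrite addr0. Qed.

Lemma lc_scale (c : R) (u : V) : u = 0 -> c *: u = 0.
Proof. by move=> ->; rewrite scaler0. Qed.

End LinearCombination.

(** * The basis y^i x^j *)

Arguments qnat : simpl never.

Lemma qnat0 (R : comNzRingType) (q : R) : qnat q 0 = 0.
Proof. by []. Qed.

Lemma qnat1 (R : comNzRingType) (q : R) : qnat q 1 = 1.
Proof. by rewrite /qnat mulr0 addr0. Qed.

Lemma qnatS (R : comNzRingType) (q : R) n : qnat q n.+1 = 1 + q * qnat q n.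
Proof. by []. Qed.

Lemma qnatSr (R : comNzRingType) (q : R) n : qnat q n.+1 = qnat q n + q ^+ n.
Proof.
elim: n => [|n IHn]; first by rewrite /qnat mulr0 add0r addr0.
by rewrite qnatS {1}IHn qnatS exprS; ring.
Qed.

Section FreeInduction.
Variable R : comNzRingType.
Local Notation F := (freealg2 R).

Lemma malgU_scale c m : << c *g m >> = c *: << m >> :> F.
Proof. by apply/malgP => k; rewrite mcoeffZ !mcoeffU mulrnAr mulr1. Qed.

Lemma free_mulr_lin c (a u v : F) : a * (c *: u + v) = c *: (a * u) + a * v.
Proof. by rewrite (freealg2_scalerAr c a u); exact: mulrDr. Qed.

Lemma free_word_ind (P : F -> Prop) :
  (forall c u v, P u -> P v -> P (c *: u + v)) -> (forall m, P << m >>) ->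
  forall u, P u.
Proof.
move=> Plin Pm u.
have P0 : P 0 by rewrite -(addNr << fmone _ >>) -scaleN1r; apply: Plin.
rewrite (monalgE u); elim: (enum_fset _) => [|m s IHs]; first by rewrite big_nil.
by rewrite big_cons malgU_scale; apply: Plin.
Qed.

Lemma free_ind (P : F -> Prop) :
  (forall c u v, P u -> P v -> P (c *: u + v)) -> P 1 ->
  (forall b u, P u -> P (fgen R b * u)) -> forall u, P u.
Proof.
move=> Plin P1 Pg; apply: free_word_ind => // -[s].
elim: s => [|b s IHs]; first by rewrite -fmoneE.
have -> : << FMonom (b :: s) >> = fgen R b * << FMonom s >> :> F.
  by rewrite /fgen malgUU mul1r /fmmul fmuE !fmE.
exact: Pg.
Qed.

End FreeInduction.

Section RegularRepresentation.
Variables (R : comNzRingType) (q r : R).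
Local Notation F := (freealg2 R).
Local Notation W := (weyl q r).
Local Notation x := (weyl_x q r).
Local Notation y := (weyl_y q r).

Lemma weyl_gen_ind (P : W -> Prop) :
  (forall c u v, P u -> P v -> P (c *: u + v)) -> P 1 ->
  (forall u, P u -> P (x * u)) -> (forall u, P u -> P (y * u)) ->
  forall u, P u.
Proof.
move=> Plin P1 Px Py; elim/weyl_ind; apply: free_ind.
- by move=> c u v Pu Pv; rewrite weyl_piD weyl_piZ; apply: Plin.
- exact: P1.
- by move=> [] u Pu; rewrite weyl_piM; [exact: Py | exact: Px].
Qed.

(* The matrix entry c i j stands for the coefficient of y^i x^j; opX and opY
   are left multiplication by x and y, opXr and opYr right multiplication. *)
Definition opY (c : nat -> nat -> R) i j := if i is i'.+1 then c i' j else 0.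
Definition opXr (c : nat -> nat -> R) i j := if j is j'.+1 then c i j' else 0.
Definition opX (c : nat -> nat -> R) i j :=
  q ^+ i * opXr c i j + r * qnat q i.+1 * c i.+1 j.
Definition opYr (c : nat -> nat -> R) i j :=
  q ^+ j * opY c i j + r * qnat q j.+1 * c i j.+1.
Definition opg (b : bool) := if b then opY else opX.

Lemma op_rel c i j : opX (opY c) i j = q * opY (opX c) i j + r * c i j.
Proof.
by rewrite /opX /opY; case: i j => [|i] [|j] /=;
  rewrite ?exprS ?qnatS ?qnat0; ring.
Qed.

Lemma opg_lin b a c d e :
  (forall i j, e i j = a * c i j + d i j) ->
  forall i j, opg b e i j = a * opg b c i j + opg b d i j.
Proof.
move=> E i j; case: b; rewrite /= /opX /opY /opXr.
  by case: i => [|i]; rewrite ?E //; ring.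
by case: j => [|j]; rewrite !E; ring.
Qed.

Lemma opXr_lin a c d e :
  (forall i j, e i j = a * c i j + d i j) ->
  forall i j, opXr e i j = a * opXr c i j + opXr d i j.
Proof. by move=> E i [|j]; rewrite /opXr ?E //; ring. Qed.

Lemma opYr_lin a c d e :
  (forall i j, e i j = a * c i j + d i j) ->
  forall i j, opYr e i j = a * opYr c i j + opYr d i j.
Proof. by move=> E i j; have /= EY := opg_lin true E; rewrite /opYr EY E; ring. Qed.

Lemma opg_opXr b c i j : opg b (opXr c) i j = opXr (opg b c) i j.
Proof. by case: b i j => [] [|i] [|j] //=; rewrite /opX /=; ring. Qed.

Lemma opg_opYr b c i j : opg b (opYr c) i j = opYr (opg b c) i j.
Proof.
case: b => /=; rewrite /opYr /opX; last first.
  by case: i j => [|i] [|j] /=; rewrite /opYr /= ?(qnatSr _ _.+1) ?qnat1 ?exprS; ring.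
by case: i => [|i] /=; rewrite /opYr /=; ring.
Qed.

Lemma op_rel_vanish (L : lalgType R) (co : L -> nat -> nat -> R) (a b u : L) :
  (forall v w i j, co (v - w) i j = co v i j - co w i j) ->
  (forall c v i j, co (c *: v) i j = c * co v i j) ->
  (forall v i j, co (a * v) i j = opX (co v) i j) ->
  (forall v i j, co (b * v) i j = opY (co v) i j) ->
  forall i j, co ((a * b - q *: (b * a) - r%:A) * u) i j = 0.
Proof.
move=> coB coZ coa cob i j.
rewrite 2!mulrBl -!scalerAl mul1r -2!mulrA !coB !coZ coa cob.
have -> : co (b * u) = opY (co u) by apply/funext => ?; apply/funext.
have -> : co (a * u) = opX (co u) by apply/funext => ?; apply/funext.
by rewrite op_rel; ring.
Qed.

Definition free_coef (u : F) i j : R :=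
  mmap idfun (fun m : {fmonom bool} =>
    foldr opg (fun i j => ((i == 0) && (j == 0))%:R) m i j) u.

Lemma free_coefZ c u i j : free_coef (c *: u) i j = c * free_coef u i j.
Proof.
rewrite /free_coef (mmapEw (msuppZ_le c u)) mmapE mulr_sumr.
by apply: eq_bigr => m _; rewrite mcoeffZ mulrA.
Qed.

Lemma free_coef_lin c u v i j :
  free_coef (c *: u + v) i j = c * free_coef u i j + free_coef v i j.
Proof. by rewrite -free_coefZ /free_coef raddfD. Qed.

Lemma free_coef_gen b u i j :
  free_coef (fgen R b * u) i j = opg b (free_coef u) i j.
Proof.
elim/free_word_ind: u i j => [c u v Eu Ev|m] i j.
  rewrite free_mulr_lin; etransitivity; first exact: free_coef_lin.
  transitivity (c * opg b (free_coef u) i j + opg b (free_coef v) i j).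
    by congr (_ * _ + _); [exact: Eu | exact: Ev].
  by symmetry; apply: opg_lin => {}i {}j; exact: free_coef_lin.
rewrite /fgen malgUU mul1r /free_coef mmapU mul1r /fmmul fmuE fmE /=.
by case: b; rewrite /= /opX /opY /opXr; case: i j => [|i] [|j]; rewrite ?mmapU ?mul1r.
Qed.

Lemma free_coefB u v i j :
  free_coef (u - v) i j = free_coef u i j - free_coef v i j.
Proof. by rewrite /free_coef raddfB. Qed.

Lemma free_coef_rel u i j : free_coef (weyl_rel q r * u) i j = 0.
Proof.
apply: (op_rel_vanish (co := free_coef)); [exact: free_coefB | exact: free_coefZ| |].
- exact: (free_coef_gen false).
- exact: (free_coef_gen true).
Qed.

Lemma free_coef_mul_eq0 a u : (forall i j, free_coef u i j = 0) ->
  forall i j, free_coef (a * u) i j = 0.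
Proof.
move=> u0; elim/free_ind: a => [c a b Ea Eb|| b a Ea] i j.
- have -> : (c *: a + b) * u = c *: (a * u) + b * u by rewrite mulrDl scalerAl.
  etransitivity; first exact: free_coef_lin.
  transitivity (c * 0 + 0 : R); last by rewrite mulr0 addr0.
  by congr (_ * _ + _); [exact: Ea | exact: Eb].
- by rewrite mul1r.
- rewrite -mulrA; etransitivity; first exact: free_coef_gen.
  by case: b; rewrite /= /opX /opY /opXr; case: i j => [|i] [|j];
     rewrite ?(Ea _ _) ?mulr0 ?addr0.
Qed.

Lemma free_coef_eq0 u : u \in tsideal (weyl_rel q r) ->
  forall i j, free_coef u i j = 0.
Proof.
move=> /tsidealP[s ->] i j; elim: s => [|p s IHs].
  by rewrite big_nil /free_coef raddf0.
rewrite big_cons -[X in X + _]scale1r; etransitivity; first exact: free_coef_lin.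
rewrite {}IHs addr0 mul1r -mulrA.
by apply: free_coef_mul_eq0 => {}i {}j; exact: free_coef_rel.
Qed.

Definition weyl_coef (u : W) i j : R := free_coef (repr u) i j.

Lemma weyl_coef_pi u i j : weyl_coef (weyl_pi q r u) i j = free_coef u i j.
Proof.
apply/eqP; rewrite /weyl_coef -subr_eq0 -free_coefB; apply/eqP/free_coef_eq0/weyl_piP.
exact: weyl_reprK.
Qed.

Lemma weyl_coef_lin c u v i j :
  weyl_coef (c *: u + v) i j = c * weyl_coef u i j + weyl_coef v i j.
Proof.
elim/weyl_ind: u => u; elim/weyl_ind: v => v.
by rewrite -weyl_piZ -weyl_piD !weyl_coef_pi free_coef_lin.
Qed.

Lemma weyl_coef1 i j : weyl_coef 1 i j = ((i == 0) && (j == 0))%:R.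
Proof.
rewrite -(weyl_pi1 q r) weyl_coef_pi /free_coef.
by rewrite -[X in mmap _ _ X]/(<< 1 *g fmone _ >>) mmapU mul1r fmoneE.
Qed.

Lemma weyl_coef_gen b u i j :
  weyl_coef (weyl_pi q r (fgen R b) * u) i j = opg b (weyl_coef u) i j.
Proof.
elim/weyl_ind: u => u; rewrite -weyl_piM weyl_coef_pi free_coef_gen.
by congr (opg b _ i j); apply/funext => ?; apply/funext => ?; rewrite weyl_coef_pi.
Qed.

Lemma weyl_coefXl u i j : weyl_coef (x * u) i j = opX (weyl_coef u) i j.
Proof. exact: weyl_coef_gen. Qed.

Lemma weyl_coefYl u i j : weyl_coef (y * u) i j = opY (weyl_coef u) i j.
Proof. exact: weyl_coef_gen. Qed.

End RegularRepresentation.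

(* The presentation of the quantum Weyl algebra together with its basis
   y^i x^j, abstracted from the quotient construction, which is too costly to
   unfold in unification problems. *)
Record pbw (R : comNzRingType) (q r : R) (A : algType R) (x y : A)
    (coef : A -> nat -> nat -> R) : Prop := Pbw {
  pbw_rel : x * y = q *: (y * x) + r%:A;
  pbw_ind : forall P : A -> Prop,
    (forall c u v, P u -> P v -> P (c *: u + v)) -> P 1 ->
    (forall u, P u -> P (x * u)) -> (forall u, P u -> P (y * u)) ->
    forall u, P u;
  pbw_coef_lin : forall c u v i j,
    coef (c *: u + v) i j = c * coef u i j + coef v i j;
  pbw_coef1 : forall i j, coef 1 i j = ((i == 0) && (j == 0))%:R;
  pbw_coefXl : forall u i j, coef (x * u) i j = opX q r (coef u) i j;
  pbw_coefYl : forall u i j, coef (y * u) i j = opY (coef u) i j }.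

Lemma weyl_pbw (R : comNzRingType) (q r : R) :
  pbw q r (weyl_x q r) (weyl_y q r) (@weyl_coef R q r).
Proof.
split; [exact: weyl_xy | exact: weyl_gen_ind | exact: weyl_coef_lin
  | exact: weyl_coef1 | exact: weyl_coefXl | exact: weyl_coefYl].
Qed.

(* X Y^i = q^i Y^i X + r [i] Y^(i-1), where the product by [i] hides the junk
   value of i.-1 at 0. *)
Lemma qcomm_exp (R : comNzRingType) (B : algType R) (q r : R) (X Y : B) :
  X * Y = q *: (Y * X) + r%:A -> forall i,
  X * Y ^+ i = q ^+ i *: (Y ^+ i * X) + (r * qnat q i) *: Y ^+ i.-1.
Proof.
move=> XY; elim=> [|i IHi].
  by rewrite !expr0 mulr1 mul1r scale1r mulr0 scale0r addr0.
rewrite exprS mulrA XY mulrDl -scalerAl -[Y * X * _]mulrA IHi -scalerAl mul1r.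
rewrite mulrDr -!scalerAr scalerDr !scalerA !mulrA -!exprS -addrA; congr (_ + _).
case: i {IHi} => [|i] /=.
  by rewrite !qnat0 qnat1 !mulr0 scale0r add0r mulr1.
by rewrite -scalerDl; congr (_ *: _); rewrite !qnatS; ring.
Qed.

Section Pbw.
Variables (R : comNzRingType) (q r : R) (A : algType R) (x y : A).
Variables (coef : A -> nat -> nat -> R) (H : pbw q r x y coef).

Let coef_lin := pbw_coef_lin H.
Let coef1 := pbw_coef1 H.
Let coefXl := pbw_coefXl H.
Let coefYl := pbw_coefYl H.

Lemma pbw_coefD u v i j : coef (u + v) i j = coef u i j + coef v i j.
Proof. by rewrite -[u]scale1r coef_lin mul1r scale1r. Qed.

Lemma pbw_coef0 i j : coef 0 i j = 0.
Proof. by have := coef_lin (-1) 0 0 i j; rewrite scaler0 addr0 mulN1r addNr. Qed.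

Lemma pbw_coefZ c u i j : coef (c *: u) i j = c * coef u i j.
Proof. by rewrite -[c *: u]addr0 coef_lin pbw_coef0 addr0. Qed.

Lemma pbw_coefN u i j : coef (- u) i j = - coef u i j.
Proof. by rewrite -scaleN1r pbw_coefZ mulN1r. Qed.

Lemma pbw_coefB u v i j : coef (u - v) i j = coef u i j - coef v i j.
Proof. by rewrite pbw_coefD pbw_coefN. Qed.

Lemma pbw_coefXr u i j : coef (u * x) i j = opXr (coef u) i j.
Proof.
elim/(pbw_ind H): u i j => [c u v Eu Ev|| u Eu| u Eu] i j.
- by rewrite mulrDl -scalerAl coef_lin Eu Ev (opXr_lin (fun i j => coef_lin c u v i j)).
- rewrite mul1r -[x]mulr1 coefXl /opX /opXr; case: j => [|j]; rewrite !coef1 /=.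
    by rewrite !mulr0 addr0.
  by case: i => [|i]; rewrite ?qnat1 ?mulr0 ?addr0 ?mul1r.
- rewrite -mulrA coefXl (_ : coef (u * x) = opXr (coef u)).
    have /= -> := opg_opXr q r false (coef u) i j; congr (opXr _ i j).
    by apply/funext => ?; apply/funext => ?; rewrite coefXl.
  by apply/funext => ?; apply/funext.
- rewrite -mulrA coefYl (_ : coef (u * x) = opXr (coef u)).
    have /= -> := opg_opXr q r true (coef u) i j; congr (opXr _ i j).
    by apply/funext => ?; apply/funext => ?; rewrite coefYl.
  by apply/funext => ?; apply/funext.
Qed.

Lemma pbw_coefYr u i j : coef (u * y) i j = opYr q r (coef u) i j.
Proof.
elim/(pbw_ind H): u i j => [c u v Eu Ev|| u Eu| u Eu] i j.
- by rewrite mulrDl -scalerAl coef_lin Eu Ev (opYr_lin q r (fun i j => coef_lin c u v i j)).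
- rewrite mul1r -[y]mulr1 coefYl /opYr /opY; case: i => [|i]; rewrite !coef1 /=.
    by rewrite !mulr0 addr0.
  by case: j => [|j]; rewrite ?andbF ?qnat1 ?mulr0 ?addr0 ?mul1r.
- rewrite -mulrA coefXl (_ : coef (u * y) = opYr q r (coef u)).
    have /= -> := opg_opYr q r false (coef u) i j; congr (opYr _ _ _ i j).
    by apply/funext => ?; apply/funext => ?; rewrite coefXl.
  by apply/funext => ?; apply/funext.
- rewrite -mulrA coefYl (_ : coef (u * y) = opYr q r (coef u)).
    have /= -> := opg_opYr q r true (coef u) i j; congr (opYr _ _ _ i j).
    by apply/funext => ?; apply/funext => ?; rewrite coefYl.
  by apply/funext => ?; apply/funext.
Qed.

Definition weyl_mon i j : A := y ^+ i * x ^+ j.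

Lemma pbw_coef_mon i j a b : coef (weyl_mon i j) a b = ((a == i) && (b == j))%:R.
Proof.
rewrite /weyl_mon; elim: i a => [|i IHi] a.
  rewrite mul1r; elim: j a b => [|j IHj] a b; first by rewrite coef1.
  by rewrite exprSr pbw_coefXr; case: b => [|b] /=; rewrite ?andbF ?IHj.
by rewrite exprS -mulrA coefYl; case: a => [|a] //=; rewrite IHi.
Qed.

Lemma mulY_mon i j : y * weyl_mon i j = weyl_mon i.+1 j.
Proof. by rewrite /weyl_mon mulrA -exprS. Qed.

Lemma mon_mulX i j : weyl_mon i j * x = weyl_mon i j.+1.
Proof. by rewrite /weyl_mon -mulrA -exprSr. Qed.


Lemma mulX_mon i j :
  x * weyl_mon i j = q ^+ i *: weyl_mon i j.+1 + (r * qnat q i) *: weyl_mon i.-1 j.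
Proof.
by rewrite /weyl_mon mulrA (qcomm_exp (pbw_rel H)) mulrDl -!scalerAl -mulrA -exprS.
Qed.

Lemma mon_ind (P : A -> Prop) :
  (forall c u v, P u -> P v -> P (c *: u + v)) -> (forall i j, P (weyl_mon i j)) ->
  forall u, P u.
Proof.
move=> Plin Pmon u; elim/(pbw_ind H): u P Plin Pmon
    => [c u v Pu Pv|| u Pu | u Pu] P Plin Pmon.
- by apply: (Plin); [exact: Pu | exact: Pv].
- by rewrite -[1]mulr1 -(expr0 y) -[X in _ * X](expr0 x); exact: Pmon.
- apply: (Pu (fun v => P (x * v))) => [c v w Pv Pw | i j].
    by rewrite mulrDr -scalerAr; exact: Plin.
  rewrite mulX_mon; apply: (Plin); first exact: Pmon.
  rewrite -[_ *: _]addr0; apply: (Plin); first exact: Pmon.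
  by rewrite -(addNr (weyl_mon 0 0)) -scaleN1r; apply: Plin.
- apply: (Pu (fun v => P (y * v))) => [c v w Pv Pw | i j].
    by rewrite mulrDr -scalerAr; exact: Plin.
  by rewrite mulY_mon.
Qed.

Definition bounds (u : A) N := forall i j, (N <= i)%N || (N <= j)%N -> coef u i j = 0.

Lemma bounds_le u N M : bounds u N -> (N <= M)%N -> bounds u M.
Proof.
move=> uN NM i j /orP h; apply: uN; apply/orP.
by case: h => h; [left | right]; apply: leq_trans h.
Qed.

Lemma bounds_lin c u v N :
  bounds u N -> bounds v N -> bounds (c *: u + v) N.
Proof. by move=> uN vN i j h; rewrite coef_lin uN // vN // mulr0 addr0. Qed.

Lemma bounds_mon i j : bounds (weyl_mon i j) (maxn i j).+1.
Proof.
move=> a b; rewrite pbw_coef_mon; case: eqP => [->|//]; case: eqP => [->|//].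
by rewrite !gtn_max !ltnn andbF.
Qed.

Lemma bounds_ex u : exists N, bounds u N.
Proof.
elim/mon_ind: u => [c u v [N uN] [M vM] | i j]; last first.
  by exists (maxn i j).+1; exact: bounds_mon.
exists (maxn N M); apply: bounds_lin; first by apply: bounds_le uN _; rewrite leq_maxl.
by apply: bounds_le vM _; rewrite leq_maxr.
Qed.

Section LinearExtension.
Variables (S : pzRingType) (V : lmodType S) (phi : {additive R -> S}).
Implicit Type e : nat -> nat -> V.

Definition wlin e (u : A) : V :=
  let N := sval (cid (bounds_ex u)) in
  \sum_(i < N) \sum_(j < N) phi (coef u i j) *: e i j.

Lemma sum_bounds e u N M : bounds u N -> (N <= M)%N ->
  \sum_(i < N) \sum_(j < N) phi (coef u i j) *: e i j
  = \sum_(i < M) \sum_(j < M) phi (coef u i j) *: e i j.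
Proof.
move=> uN NM; pose F i j := phi (coef u i j) *: e i j.
have F0 i j : (N <= i)%N || (N <= j)%N -> F i j = 0.
  by move=> h; rewrite /F uN // raddf0 scale0r.
rewrite (big_ord_widen M (fun i => \sum_(j < N) F i j) NM).
rewrite big_mkcond /=; apply: eq_bigr => i _; case: ifP => iN; last first.
  by rewrite big1 // => j _; rewrite [LHS]F0 // leqNgt iN.
rewrite (big_ord_widen M (F i) NM) big_mkcond /=; apply: eq_bigr => j _.
by case: ifP => // jN; rewrite [RHS]F0 // (leqNgt N j) jN orbT.
Qed.

Lemma wlinE e u N : bounds u N ->
  wlin e u = \sum_(i < N) \sum_(j < N) phi (coef u i j) *: e i j.
Proof.
rewrite /wlin; case: cid => M /= uM uN.
rewrite (sum_bounds e uM (leq_maxl M N)) (sum_bounds e uN (leq_maxr M N)) //.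
Qed.

Lemma wlinD e u v : wlin e (u + v) = wlin e u + wlin e v.
Proof.
have [N uN] := bounds_ex u; have [M vM] := bounds_ex v.
have u' := bounds_le uN (leq_maxl N M); have v' := bounds_le vM (leq_maxr N M).
have w' : bounds (u + v) (maxn N M) by rewrite -[u]scale1r; exact: bounds_lin.
rewrite (wlinE e u') (wlinE e v') (wlinE e w') -big_split; apply: eq_bigr => i _.
by rewrite -big_split; apply: eq_bigr => j _; rewrite /= pbw_coefD raddfD scalerDl.
Qed.

Lemma wlinZ_sub e c c' u : (forall d, phi (c * d) = c' * phi d) ->
  wlin e (c *: u) = c' *: wlin e u.
Proof.
move=> cc'; have [N uN] := bounds_ex u.
have w' : bounds (c *: u) N by move=> i j h; rewrite pbw_coefZ uN // mulr0.
rewrite (wlinE e uN) (wlinE e w') scaler_sumr; apply: eq_bigr => i _.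
by rewrite scaler_sumr; apply: eq_bigr => j _; rewrite pbw_coefZ cc' scalerA.
Qed.

Lemma wlin_mon e i j : wlin e (weyl_mon i j) = phi 1 *: e i j.
Proof.
rewrite (wlinE e (@bounds_mon i j)).
have iN : (i < (maxn i j).+1)%N by rewrite ltnS leq_maxl.
have jN : (j < (maxn i j).+1)%N by rewrite ltnS leq_maxr.
rewrite (bigD1 (Ordinal iN)) //= [X in _ + X]big1 ?addr0 => [|i' ii']; last first.
  rewrite big1 // => j' _; rewrite pbw_coef_mon.
  by rewrite (_ : (i' == i :> nat) = false) ?raddf0 ?scale0r //; exact: negbTE.
rewrite (bigD1 (Ordinal jN)) //= [X in _ + X]big1 ?addr0 => [|j' jj']; last first.
  rewrite pbw_coef_mon (_ : (j' == j :> nat) = false) ?andbF ?raddf0 ?scale0r //.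
  exact: negbTE.
by rewrite pbw_coef_mon !eqxx.
Qed.

End LinearExtension.

End Pbw.

(** * Universal properties *)

Section Semilinear.
Variables (R S : comNzRingType) (phi : {rmorphism R -> S}).
Variables (U : lmodType R) (V : lmodType S).

Definition semilin (g : U -> V) :=
  forall c u v, g (c *: u + v) = phi c *: g u + g v.

Variables (g : U -> V) (gl : semilin g).

Lemma semilinD u v : g (u + v) = g u + g v.
Proof. by rewrite -[u]scale1r gl rmorph1 !scale1r. Qed.

Lemma semilin0 : g 0 = 0.
Proof. by have := gl (-1) 0 0; rewrite scaler0 addr0 rmorphN1 scaleN1r addNr. Qed.

Lemma semilinZ c u : g (c *: u) = phi c *: g u.
Proof. by rewrite -[c *: u]addr0 gl semilin0 addr0. Qed.

Lemma semilin_sum (I : Type) (s : seq I) (F : I -> U) :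
  g (\sum_(i <- s) F i) = \sum_(i <- s) g (F i).
Proof.
elim: s => [|i s IHs]; first by rewrite !big_nil semilin0.
by rewrite !big_cons semilinD IHs.
Qed.

End Semilinear.

Section PbwMaps.
Variables (R : comNzRingType) (q r : R) (A : algType R) (x y : A).
Variables (coef : A -> nat -> nat -> R) (H : pbw q r x y coef).
Local Notation mon := (weyl_mon x y).

Lemma mon00 : mon 0 0 = 1.
Proof. by rewrite /weyl_mon !expr0 mulr1. Qed.

Lemma semilin_ext (S : comNzRingType) (phi : {rmorphism R -> S})
    (V : lmodType S) (e : nat -> nat -> V) :
  exists2 g : A -> V, semilin phi g & forall i j, g (mon i j) = e i j.
Proof.
exists (wlin H phi e) => [c u v | i j]; last by rewrite wlin_mon /= rmorph1 scale1r.
by rewrite wlinD; congr (_ + _); apply: wlinZ_sub => d; rewrite /= rmorphM.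
Qed.

Lemma linear_ext (V : lmodType R) (e : nat -> nat -> V) :
  exists2 g : A -> V, semilin idfun g & forall i j, g (mon i j) = e i j.
Proof. exact: semilin_ext. Qed.

Lemma eq_semilin (S : comNzRingType) (phi : {rmorphism R -> S})
    (V : lmodType S) (g h : A -> V) :
  semilin phi g -> semilin phi h ->
  (forall i j, g (mon i j) = h (mon i j)) -> g =1 h.
Proof.
move=> gl hl gh; apply: (mon_ind H) => [c u v Eu Ev|i j]; last exact: gh.
by rewrite gl hl Eu Ev.
Qed.

Lemma rmorph_qnat (S : comNzRingType) (phi : {rmorphism R -> S}) n :
  phi (qnat q n) = qnat (phi q) n.
Proof.
by elim: n => [|n IHn]; rewrite ?qnat0 ?rmorph0 // !qnatS rmorphD rmorph1 rmorphM IHn.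
Qed.

Record semihom (S : comNzRingType) (phi : {rmorphism R -> S}) (B : algType S)
    (g : A -> B) : Prop := SemiHom {
  semihom_linear :> semilin phi g;
  semihom1 : g 1 = 1;
  semihomM : forall u v, g (u * v) = g u * g v }.

Lemma semihom_ext (S : comNzRingType) (phi : {rmorphism R -> S})
    (B : algType S) (X Y : B) :
  X * Y = phi q *: (Y * X) + (phi r)%:A ->
  exists2 g : A -> B, semihom phi g & g x = X /\ g y = Y.
Proof.
move=> XY; have [g gl gm] := semilin_ext phi (fun i j => Y ^+ i * X ^+ j).
have g1 : g 1 = 1 by rewrite -mon00 gm !expr0 mulr1.
have gY u : g (y * u) = Y * g u.
  elim/(mon_ind H): u => [c u v Eu Ev | i j].
    by rewrite mulrDr -scalerAr !gl Eu Ev mulrDr -scalerAr.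
  by rewrite mulY_mon !gm exprS mulrA.
have gX u : g (x * u) = X * g u.
  elim/(mon_ind H): u => [c u v Eu Ev | i j].
    by rewrite mulrDr -scalerAr !gl Eu Ev mulrDr -scalerAr.
  rewrite (mulX_mon H) gl (semilinZ gl) !gm mulrA (qcomm_exp XY) mulrDl.
  by rewrite -!scalerAl exprS mulrA !(rmorphM, rmorphXn, rmorph_qnat).
exists g; last by rewrite -[x]mulr1 -[y]mulr1 gX gY g1 !mulr1.
split=> // u v; elim/(pbw_ind H): u => [c u w Eu Ew || u Eu | u Eu].
- by rewrite mulrDl -scalerAl !gl Eu Ew mulrDl scalerAl.
- by rewrite g1 !mul1r.
- by rewrite -mulrA !gX Eu mulrA.
- by rewrite -mulrA !gY Eu mulrA.
Qed.

Lemma semihomX (S : comNzRingType) (phi : {rmorphism R -> S}) (B : algType S)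
    (g : A -> B) u n : semihom phi g -> g (u ^+ n) = g u ^+ n.
Proof. by case=> _ g1 gM; elim: n => [|n IHn] //; rewrite !exprS gM IHn. Qed.

Lemma semihom_mon (S : comNzRingType) (phi : {rmorphism R -> S}) (B : algType S)
    (g : A -> B) i j : semihom phi g -> g (mon i j) = g y ^+ i * g x ^+ j.
Proof. by move=> gh; rewrite /weyl_mon (semihomM gh) !(semihomX _ _ gh). Qed.

Definition bilinear_cochain (f : A -> A -> A) :=
  (forall b, semilin idfun (f^~ b)) /\ (forall a, semilin idfun (f a)).

Definition cocycle2 (f : A -> A -> A) :=
  forall a b c, f (a * b) c + f a b * c = a * f b c + f a (b * c).

(* The first-order term of the relator of A in the square-zero extension
   attached to the cocycle f. *)
Definition obstruction (f : A -> A -> A) :=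
  f x y - q *: f y x + r *: f 1 1.

(* The change of the relator when x, y are replaced by x + a, y + b. *)
Definition koszul_diff a b := a * y + x * b - q *: (b * x + y * a).

(* In the square-zero extension attached to f, the lifts (x, p) and (y, s)
   satisfy the defining relation of A, hence define a section u |-> (u, g u)
   which is an algebra morphism. *)
Lemma section_ext f p s :
  bilinear_cochain f -> cocycle2 f -> koszul_diff p s + obstruction f = 0 ->
  exists2 g : A -> A, semilin idfun g
    & [/\ g x = p, g y = s & forall a b, g (a * b) = a * g b + g a * b + f a b].
Proof.
move=> [fl fr] fc rel.
pose e0 := fix e0 j := if j is j'.+1 then x * e0 j' + p * x ^+ j' + f x (x ^+ j')
                       else - f 1 1.
pose e := fix e i j := if i is i'.+1 then y * e i' j + s * mon i' j + f y (mon i' j)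
                       else e0 j.
have [g gl gm] := linear_ext e; exists g => //.
have gY u : g (y * u) = y * g u + s * u + f y u.
  elim/(mon_ind H): u => [c u v Eu Ev | i j]; last by rewrite mulY_mon !gm.
  rewrite mulrDr -scalerAr !gl fr Eu Ev /=.
  by alg_expand; lmod R A.
have f1 u : f 1 u = f 1 1 * u.
  by have := fc 1 1 u; rewrite !mul1r => /addrI ->.
have gX u : g (x * u) = x * g u + p * u + f x u.
  elim/(mon_ind H): u => [c u v Eu Ev | i j].
    rewrite mulrDr -scalerAr !gl fr Eu Ev /=.
    by alg_expand; lmod R A.
  elim: i => [|i IHi].
    by rewrite !gm /= /weyl_mon mul1r -exprS -[x ^+ _]mul1r -(expr0 y) gm.
  rewrite -mulY_mon; move: (mon i j) IHi => u IHi.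
  rewrite mulrA (pbw_rel H) mulrDl -!scalerAl mul1r -mulrA gl (semilinZ gl) /=.
  rewrite !gY IHi.
  have E1 := fc x y u; have E2 := fc y x u.
  rewrite (pbw_rel H) fl (semilinZ (fl u)) f1 /= in E1.
  have E3 := congr1 ( *%R^~ u) rel; have E4 := congr1 ( *%R^~ (g u)) (pbw_rel H).
  move: E1 E2 E3 E4; rewrite /koszul_diff /obstruction; alg_expand => E1 E2 E3 E4.
  apply: lc_use (lc_add (lc_eq E1) (lc_add (lc_scale (- q) (lc_eq E2))
    (lc_add (lc_scale (-1) (lc_eq E3)) (lc_scale (-1) (lc_eq E4))))) _.
  by lmod R A.
have g1 : g 1 = - f 1 1 by have := gm 0 0; rewrite mon00.
have fr1 u : f u 1 = u * f 1 1.
  by have := fc u 1 1; rewrite !mulr1 addrC => /addIr ->.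
exists; first by rewrite -[x]mulr1 gX g1 (fr1 x) mulrN mulr1 addrAC addNr add0r.
  by rewrite -[y]mulr1 gY g1 (fr1 y) mulrN mulr1 addrAC addNr add0r.
move=> a b; elim/(pbw_ind H): a => [c u v Eu Ev || u Eu | u Eu].
- rewrite mulrDl -scalerAl !gl Eu Ev fl /=.
  by alg_expand; lmod R A.
- by rewrite !mul1r g1 (f1 b) mulNr subrK.
- rewrite -mulrA !gX Eu; have := fc x u b; alg_expand => E1.
  by apply: lc_use (lc_scale (-1) (lc_eq E1)) _; lmod R A.
- rewrite -mulrA !gY Eu; have := fc y u b; alg_expand => E1.
  by apply: lc_use (lc_scale (-1) (lc_eq E1)) _; lmod R A.
Qed.

End PbwMaps.

(** * The deformation cocycle *)

Definition coboundary (R : comNzRingType) (A : algType R) (g : A -> A) a b :=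
  a * g b - g (a * b) + g a * b.

Section DeformationCocycle.
Variables (R : comNzRingType) (q r : R) (A : algType R) (x y : A).
Variables (coef : A -> nat -> nat -> R) (H : pbw q r x y coef).
Local Notation mon := (weyl_mon x y).

(* q d/dq of the multiplication of A, written in the basis y^i x^j, is a
   2-cocycle f; left multiplication by y does not depend on q in this basis,
   and F is f(x, -). *)
Record qderiv (F : A -> A) (f : A -> A -> A) : Prop := QDeriv {
  qderivF : semilin idfun F;
  qderivFX : forall j, F (x ^+ j) = 0;
  qderivFY : forall u, F (y * u) = q *: (y * x * u) + q *: (y * F u);
  qderiv_bilinear : bilinear_cochain f;
  qderiv1 : forall c, f 1 c = 0;
  qderivY : forall a c, f (y * a) c = y * f a c;
  qderivX : forall a c, f (x * a) c = x * f a c + F (a * c) - F a * c }.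

Lemma qderiv_ex : exists F f, qderiv F f.
Proof.
pose eF := fix eF i j := if i is i'.+1
  then q *: (y * x * mon i' j) + q *: (y * eF i' j) else 0.
have [F Fl Fm] := linear_ext H eF.
have FX j : F (x ^+ j) = 0 by rewrite -[x ^+ j]mul1r -(expr0 y) Fm.
have FY u : F (y * u) = q *: (y * x * u) + q *: (y * F u).
  elim/(mon_ind H): u => [c u v Eu Ev | i j]; last by rewrite mulY_mon !Fm.
  by rewrite mulrDr -scalerAr !Fl Eu Ev /=; alg_expand; lmod R A.
pose e0 := fix e0 j (c : A) := if j is j'.+1
  then x * e0 j' c + F (x ^+ j' * c) else 0.
pose e i j : A -> A := fun c => y ^+ i * e0 j c.
have [f fl fm] := linear_ext H e.
have fl1 c : semilin idfun (f^~ c) by move=> d u v; rewrite fl.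
have fY a c : f (y * a) c = y * f a c.
  elim/(mon_ind H): a => [d u v Eu Ev | i j].
    by rewrite mulrDr -scalerAr !fl1 Eu Ev /=; alg_expand; lmod R A.
  by rewrite mulY_mon !fm /e exprS mulrA.
have fX a c : f (x * a) c = x * f a c + F (a * c) - F a * c.
  elim/(mon_ind H): a => [d u v Eu Ev | i j].
    rewrite mulrDr -scalerAr mulrDl -scalerAl !fl1 Eu Ev !Fl /=.
    by alg_expand; lmod R A.
  elim: i => [|i IHi].
    rewrite /weyl_mon mul1r -exprS -[x ^+ j.+1]mul1r -[X in f X c = _ + _ - _]/(mon 0 _).
    rewrite -[X in _ = _ * f X c + _ - _]mul1r -(expr0 y) -/(mon 0 j).
    by rewrite -/(mon 0 j.+1) !fm /e !mul1r FX mul0r subr0.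
  rewrite -mulY_mon; move: (mon i j) IHi => u IHi.
  rewrite mulrA (pbw_rel H) mulrDl -!scalerAl mul1r fl1 (semilinZ (fl1 c)).
  rewrite -(mulrA y x u) !fY IHi -?(mulrA y u c) !FY /=.
  have E4 := congr1 ( *%R^~ (f u c)) (pbw_rel H); move: E4; alg_expand => E4.
  by apply: lc_use (lc_scale (-1) (lc_eq E4)) _; lmod R A.
exists F, f; split=> // [|c].
  split=> // a d u v; elim/(mon_ind H): a => [k a b Ea Eb | i j].
    by rewrite !fl1 Ea Eb /=; alg_expand; lmod R A.
  rewrite !fm /e scalerAr -mulrDr; congr (_ * _).
  elim: j => [|j IHj] /=; first by rewrite scaler0 addr0.
  by rewrite IHj (mulrDr (x ^+ j)) -(scalerAr d) Fl /=; alg_expand; lmod R A.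
by rewrite -(mon00 x y) fm /e mulr0.
Qed.

Lemma qderiv_cocycle F f : qderiv F f -> cocycle2 f.
Proof.
case=> Fl FX FY [fl fr] f1 fY fX a b c.
elim/(pbw_ind H): a => [k u v Eu Ev || u Eu | u Eu].
- have := congr2 +%R (congr1 (GRing.scale k) Eu) Ev.
  rewrite !(mulrDl, scalerDr) -!scalerAl !fl /= => E; alg_expand.
  by apply: lc_use (lc_eq E) _; alg_expand; lmod R A.
- by rewrite !mul1r !f1 mul0r !addr0.
- rewrite -mulrA !fX; move: (congr1 ( *%R x) Eu); alg_expand => E.
  by apply: lc_use (lc_eq E) _; lmod R A.
- by rewrite -!mulrA !fY -!mulrA -mulrDr Eu mulrDr.
Qed.

Lemma qderiv_obstruction F f : qderiv F f -> obstruction q r x y f = q *: (y * x).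
Proof.
case=> Fl FX FY [fl fr] f1 fY fX; rewrite /obstruction.
have F1 : F 1 = 0 by rewrite -(expr0 x).
have -> : f x y = q *: (y * x).
  by rewrite -[x in f x]mulr1 fX f1 F1 -[y in F (_ * y)]mulr1 mul1r FY F1;
     alg_expand; lmod R A.
have -> : f y x = 0 by rewrite -[y in f y]mulr1 fY f1 mulr0.
by rewrite f1; lmod R A.
Qed.

Lemma coboundary_bilinear (g : A -> A) : semilin idfun g -> bilinear_cochain (coboundary g).
Proof.
by move=> gl; split=> a c u v; rewrite /coboundary /=;
  alg_expand; rewrite !gl /=; alg_expand; lmod R A.
Qed.

Lemma coboundary_cocycle (g : A -> A) : cocycle2 (coboundary g).
Proof. by move=> a b c; rewrite /coboundary; alg_expand; lmod R A. Qed.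

Lemma coboundary_obstruction (g : A -> A) : semilin idfun g ->
  obstruction q r x y (coboundary g) = koszul_diff q x y (g x) (g y).
Proof.
move=> gl; rewrite /obstruction /koszul_diff /coboundary (pbw_rel H) gl (semilinZ gl) /=.
by alg_expand; lmod R A.
Qed.

(* At r = 0 the operator G is x d/dx y d/dy, and adding half its coboundary
   antisymmetrizes qderiv. *)
Definition wedge_cocycle (half : R) (f : A -> A -> A) := exists F f0 G,
  [/\ qderiv F f0, semilin idfun G,
      forall i j, G (mon i j) = (i * j)%:R *: mon i j
    & forall a b, f a b = f0 a b + half *: coboundary G a b].

Lemma wedge_cocycle_ex half : exists f, wedge_cocycle half f.
Proof.
have [F [f0 Ff0]] := qderiv_ex.
have [G Gl Gm] := linear_ext H (fun i j => (i * j)%:R *: mon i j).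
by exists (fun a b => f0 a b + half *: coboundary G a b), F, f0, G.
Qed.

Lemma wedge_cocycle_bilinear half f : wedge_cocycle half f -> bilinear_cochain f.
Proof.
move=> [F [f0 [G [[_ _ _ [fl fr] _ _ _] Gl _ fE]]]].
have [cl cr] := coboundary_bilinear Gl.
split=> a c u v; rewrite !fE.
  by rewrite fl cl /=; lmod R A.
by rewrite fr cr /=; lmod R A.
Qed.

Lemma wedge_cocycle_cocycle half f : wedge_cocycle half f -> cocycle2 f.
Proof.
move=> [F [f0 [G [Ff _ _ fE]]]] a b c; rewrite !fE.
have E0 := qderiv_cocycle Ff a b c; have E1 := coboundary_cocycle G a b c.
move: (coboundary G) E1 {fE} => g E1.
alg_expand; apply: lc_use (lc_add (lc_eq E0) (lc_scale half (lc_eq E1))) _.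
by lmod R A.
Qed.

Lemma wedge_cocycle_obstruction half f : wedge_cocycle half f ->
  obstruction q r x y f = q *: (y * x).
Proof.
move=> [F [f0 [G [Ff Gl Gm fE]]]]; rewrite -(qderiv_obstruction Ff).
have E := coboundary_obstruction Gl.
have Gx : G x = 0 by have := Gm 0 1; rewrite /weyl_mon mul1r expr1 scale0r.
have Gy : G y = 0 by have := Gm 1 0; rewrite /weyl_mon mulr1 expr1 muln0 scale0r.
move: E; rewrite /obstruction /koszul_diff Gx Gy !fE; move: (coboundary G) => g E.
move: E; alg_expand => E; apply: lc_use (lc_scale half (lc_eq E)) _.
by lmod R A.
Qed.

End DeformationCocycle.

Section Naturality.
Variables (R S : comNzRingType) (phi : {rmorphism R -> S}) (q r : R) (q' : S).
Variables (A : algType R) (x y : A) (coef : A -> nat -> nat -> R).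
Variables (B : algType S) (x' y' : B).
Hypothesis (HA : pbw q r x y coef).
Variable (g : A -> B).
Hypotheses (gh : semihom phi g) (gx : g x = x') (gy : g y = y') (qq' : phi q = q').

Lemma qderiv_natural F f F' f' :
  qderiv q x y F f -> qderiv q' x' y' F' f' ->
  forall a b, g (f a b) = f' (g a) (g b).
Proof.
case: gh => gl g1 gM; have [gD gB] := (semilinD gl, semilinZ gl).
case=> Fl FX FY [fl fr] f1 fY fX [Fl' FX' FY' [fl' fr'] f1' fY' fX'].
have g0 := semilin0 gl.
have FF' u : g (F u) = F' (g u).
  elim/(mon_ind HA): u => [c u v Eu Ev | i j].
    by rewrite Fl !gl Eu Ev Fl'.
  elim: i => [|i IHi].
    by rewrite (semihom_mon x y _ _ gh) gx /weyl_mon !mul1r FX FX'.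
  rewrite -mulY_mon; move: (weyl_mon x y i j) IHi => u IHi.
  by rewrite FY gl gB !gM gx gy FY' -IHi /= qq'.
move=> a b; elim/(pbw_ind HA): a => [c u v Eu Ev || u Eu | u Eu].
- by rewrite fl !gl Eu Ev fl'.
- by rewrite f1 g0 g1 f1'.
- by rewrite fX !gD -scaleN1r gB rmorphN1 scaleN1r !gM gx Eu fX' !FF' gM.
- by rewrite fY !gM gy fY' Eu.
Qed.

Lemma wedge_cocycle_natural half f f' :
  wedge_cocycle q x y half f -> wedge_cocycle q' x' y' (phi half) f' ->
  forall a b, g (f a b) = f' (g a) (g b).
Proof.
move=> [F [f0 [G [Ff Gl Gm fE]]]] [F' [f0' [G' [Ff' Gl' Gm' fE']]]] a b.
have [gl g1 gM] := gh; have [gD gZ] := (semilinD gl, semilinZ gl).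
have GG' u : g (G u) = G' (g u).
  elim/(mon_ind HA): u => [c u v Eu Ev | i j]; first by rewrite Gl !gl Eu Ev Gl'.
  by rewrite Gm gZ (semihom_mon x y _ _ gh) gx gy -/(weyl_mon x' y' i j) Gm' rmorph_nat.
rewrite fE fE' gD (qderiv_natural Ff Ff') gZ /coboundary !gD -scaleN1r gZ.
by rewrite rmorphN1 scaleN1r !gM !GG' gM.
Qed.

End Naturality.

Section QuantumPlane.
Variables (R : comNzRingType) (q : R) (A : algType R) (x y : A).
Variables (coef : A -> nat -> nat -> R) (H : pbw q 0 x y coef).
Local Notation mon := (weyl_mon x y).

Variables (Dx Dy : A -> A).
Hypotheses (Dxl : semilin idfun Dx) (Dyl : semilin idfun Dy).
Hypotheses (DxM : forall u v, Dx (u * v) = Dx u * v + u * Dx v).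
Hypotheses (DyM : forall u v, Dy (u * v) = Dy u * v + u * Dy v).
Hypotheses (Dxx : Dx x = x) (Dxy : Dx y = 0) (Dyx : Dy x = 0) (Dyy : Dy y = y).

Lemma deriv1 (D : A -> A) :
  (forall u v, D (u * v) = D u * v + u * D v) -> D 1 = 0.
Proof. by move=> /(_ 1 1); rewrite !mulr1 mul1r -{1}[D 1]addr0 => /addrI. Qed.

Lemma Dy_expX j : Dy (x ^+ j) = 0.
Proof.
elim: j => [|j IHj]; first exact: deriv1.
by rewrite exprS DyM Dyx IHj mul0r mulr0 addr0.
Qed.

Lemma Dx_mon i j : Dx (mon i j) = j%:R *: mon i j.
Proof.
elim: i => [|i IHi]; last first.
  by rewrite -mulY_mon DxM Dxy mul0r add0r IHi -scalerAr.
rewrite /weyl_mon mul1r; elim: j => [|j IHj]; first by rewrite scale0r; exact: deriv1.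
by rewrite exprS DxM Dxx IHj -scalerAr mulrSr scalerDl scale1r addrC.
Qed.

Lemma Dy_mon i j : Dy (mon i j) = i%:R *: mon i j.
Proof.
elim: i => [|i IHi].
  by rewrite /weyl_mon mul1r Dy_expX scale0r.
by rewrite -mulY_mon DyM Dyy IHi -scalerAr mulrSr scalerDl scale1r addrC.
Qed.

Lemma qderiv_plane F f : qderiv q x y F f -> forall a b, f a b = Dx a * Dy b.
Proof.
case=> Fl FX FY [fl fr] f1 fY fX.
have xy : x * y = q *: (y * x) by rewrite (pbw_rel H) scale0r addr0.
have FE u : F u = x * Dy u.
  elim/(mon_ind H): u => [c u v Eu Ev | i j].
    by rewrite Fl Dyl Eu Ev mulrDr -scalerAr.
  elim: i => [|i IHi]; first by rewrite /weyl_mon mul1r FX Dy_expX mulr0.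
  rewrite -mulY_mon FY IHi DyM Dyy mulrDr !mulrA xy -!scalerAl -!mulrA.
  by [].
move=> a b; elim/(pbw_ind H): a => [c u v Eu Ev || u Eu | u Eu].
- by rewrite fl Eu Ev Dxl mulrDl -scalerAl.
- by rewrite f1 (deriv1 DxM) mul0r.
- rewrite fX Eu !FE DyM DxM Dxx.
  by alg_expand; lmod R A.
- by rewrite fY Eu DxM Dxy mul0r add0r mulrA.
Qed.

Lemma wedge_cocycle_plane half f : half + half = 1 -> wedge_cocycle q x y half f ->
  forall a b, f a b = half *: (Dx a * Dy b - Dy a * Dx b).
Proof.
move=> half2 [F [f0 [G [Ff Gl Gm fE]]]] a b.
have GE u : G u = Dx (Dy u).
  elim/(mon_ind H): u => [c u v Eu Ev | i j]; first by rewrite Gl Dyl Dxl Eu Ev.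
  by rewrite Gm Dy_mon (semilinZ Dxl) Dx_mon scalerA -natrM.
rewrite fE (qderiv_plane Ff) /coboundary !GE DyM (semilinD Dxl) !DxM.
by alg_expand; lmod R A; transitivity (1 - half); [ring | rewrite -{1}half2; ring].
Qed.

End QuantumPlane.

(** * Linear algebra of the Koszul differential *)

Section CoefInjective.
Variables (R : comNzRingType) (q r : R) (A : algType R) (x y : A).
Variables (coef : A -> nat -> nat -> R) (H : pbw q r x y coef).
Local Notation mon := (weyl_mon x y).

Lemma wlin_id u : wlin H idfun mon u = u.
Proof.
apply: (eq_semilin (phi := idfun) H (g := wlin H idfun mon) (h := id)) => // [c v w | i j].
  by rewrite wlinD; congr (_ + _); exact: wlinZ_sub.
by rewrite wlin_mon scale1r.
Qed.

Lemma pbw_coef_inj u v : (forall i j, coef u i j = coef v i j) -> u = v.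
Proof.
move=> uv; rewrite -(wlin_id u) -(wlin_id v).
have [N uN] := bounds_ex H u.
have vN : bounds coef v N by move=> i j /uN; rewrite uv.
rewrite (wlinE _ _ _ uN) (wlinE _ _ _ vN); apply: eq_bigr => i _.
by apply: eq_bigr => j _; rewrite uv.
Qed.

Lemma mon_mulY i j :
  mon i j * y = q ^+ j *: mon i.+1 j + (r * qnat q j) *: mon i j.-1.
Proof.
elim: j => [|j IHj].
  by rewrite qnat0 mulr0 scale0r addr0 scale1r /weyl_mon !mulr1 exprSr.
rewrite -mon_mulX -mulrA (pbw_rel H) mulrDr -!scalerAr mulr1 mulrA IHj.
rewrite mulrDl -!scalerAl !mon_mulX scalerDr !scalerA -exprS -addrA; congr (_ + _).
case: j {IHj} => [|j] /=.
  by rewrite !(qnat0, qnat1) !mulr0 scale0r add0r mulr1.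
by rewrite -scalerDl !qnatS; congr (_ *: _); ring.
Qed.

End CoefInjective.

Section WeylCohomology.
Variables (k : fieldType) (q : k) (A : algType k) (x y : A).
Variables (coef : A -> nat -> nat -> k) (H : pbw q 1 x y coef).
Hypotheses (q0 : q != 0) (qN : forall N, (0 < N)%N -> q ^+ N != 1).
Local Notation mon := (weyl_mon x y).
Local Notation koszul := (koszul_diff q x y).

Lemma qnatE n : (1 - q) * qnat q n = 1 - q ^+ n.
Proof. elim: n => [|n IHn]; first by rewrite qnat0 mulr0 subrr.
by rewrite qnatS exprS mulrDr mulrCA IHn; ring. Qed.

Lemma qnat_neq0 n : (0 < n)%N -> qnat q n != 0.
Proof.
move=> n0; apply: contraNneq (qN n0) => E; move: (qnatE n).
by rewrite E mulr0 => /esym/subr0_eq ->.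
Qed.

Lemma expq_neq n : n != 1%N -> q ^+ n - q != 0.
Proof.
case: n => [|[|n]] // _; first by rewrite subr_eq0 eq_sym; exact: (qN (N := 1)).
by rewrite exprS -{3}[q]mulr1 -mulrBr mulf_eq0 negb_or q0 subr_eq0 qN.
Qed.

Lemma expq_neq1 n : (0 < n)%N -> q ^+ n - 1 != 0.
Proof. by move=> n0; rewrite subr_eq0 qN. Qed.

Lemma center_scalar u : x * u = u * x -> y * u = u * y -> u = coef u 0 0 *: 1.
Proof.
move=> xu yu; set c := coef u.
have Ex i j : (q ^+ i - 1) * opXr c i j + qnat q i.+1 * c i.+1 j = 0.
  have := congr1 (fun v => coef v i j) xu.
  by rewrite (pbw_coefXl H) (pbw_coefXr H) /opX -/c => E; apply: lc_use (lc_eq E) _; ring.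
have Ey i j : (q ^+ j - 1) * opY c i j + qnat q j.+1 * c i j.+1 = 0.
  have := congr1 (fun v => coef v i j) yu.
  rewrite (pbw_coefYl H) (pbw_coefYr H) /opYr -/c => E.
  by apply: lc_use (lc_eq (esym E)) _; ring.
have c1 i j : c i.+1 j = 0.
  elim: i j => [|i IHi] j; have := Ex _ j; last move=> /(_ i.+1); last first.
    rewrite (_ : opXr c i.+1 j = 0) ?mulr0 ?add0r; last by case: j => /=.
    by move=> /eqP; rewrite mulf_eq0 (negPf (qnat_neq0 _)) // => /eqP.
  by move=> /(_ 0) /eqP; rewrite subrr mul0r add0r mulf_eq0 (negPf (qnat_neq0 _)) // => /eqP.
have c2 i j : c i j.+1 = 0.
  elim: j i => [|j IHj] i; have := Ey i.
    by move=> /(_ 0) /eqP; rewrite subrr mul0r add0r mulf_eq0 (negPf (qnat_neq0 _)) // => /eqP.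
  move=> /(_ j.+1); rewrite (_ : opY c i j.+1 = 0) ?mulr0 ?add0r; last by case: i => /=.
  by move=> /eqP; rewrite mulf_eq0 (negPf (qnat_neq0 _)) // => /eqP.
apply: (pbw_coef_inj H) => i j; rewrite (pbw_coefZ H) (pbw_coef1 H) -/c.
by case: i j => [|i] [|j]; rewrite ?c1 ?c2 ?mulr0 ?mulr1.
Qed.

Lemma coef_koszul a b i j : coef (koszul a b) i j =
  (q ^+ j - q) * opY (coef a) i j + qnat q j.+1 * coef a i j.+1
  + (q ^+ i - q) * opXr (coef b) i j + qnat q i.+1 * coef b i.+1 j.
Proof.
rewrite /koszul_diff (pbw_coefB H) (pbw_coefD H) (pbw_coefZ H) (pbw_coefD H).
rewrite (pbw_coefXl H) (pbw_coefXr H).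
by rewrite (pbw_coefYl H) (pbw_coefYr H) /opX /opYr; ring.
Qed.

Lemma koszul_inner u : koszul (x * u - u * x) (y * u - u * y) = 0.
Proof.
rewrite /koszul_diff; have E1 := congr1 ( *%R^~ u) (pbw_rel H).
have E2 := congr1 ( *%R u) (pbw_rel H); move: E1 E2; alg_expand => E1 E2.
by apply: lc_use (lc_add (lc_eq E1) (lc_scale (-1) (lc_eq E2))) _; lmod k A.
Qed.

Lemma mod_inner_axes a : exists u, forall i j,
  coef (a - (x * u - u * x)) i.+1 j.+1 = 0.
Proof.
pose P a := exists u, forall i j, coef (a - (x * u - u * x)) i.+1 j.+1 = 0.
have Plin c v w : P v -> P w -> P (c *: v + w).
  move=> [s Es] [t Et]; exists (c *: s + t) => i j.
  have -> : c *: v + w - (x * (c *: s + t) - (c *: s + t) * x)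
      = c *: (v - (x * s - s * x)) + (w - (x * t - t * x)).
    by alg_expand; lmod k A.
  by rewrite (pbw_coef_lin H) Es Et mulr0 addr0.
have Pcomm u : P (x * u - u * x) by exists u => i j; rewrite subrr (pbw_coef0 H).
have P0 : P 0 by have := Pcomm 0; rewrite mulr0 mul0r subr0.
rewrite -/(P a); elim/(mon_ind H): a => [c v w|i j]; first exact: Plin.
elim: i j => [|i IHi] j.
  exists 0 => i' j'; rewrite mulr0 mul0r !subr0 (pbw_coef_mon H).
  by [].
case: j => [|j].
  by exists 0 => i' j'; rewrite mulr0 mul0r !subr0 (pbw_coef_mon H) andbF.
have n0 := expq_neq1 (ltn0Sn i).
have -> : mon i.+1 j.+1 = (q ^+ i.+1 - 1)^-1 *:
    (x * mon i.+1 j - mon i.+1 j * x + (- qnat q i.+1) *: mon i j + 0).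
  rewrite addr0 (mulX_mon H) mon_mulX mul1r /=.
  by apply: (scalerI n0); rewrite scalerA mulfV // scale1r; lmod k A.
rewrite -[_ *: _]addr0; apply: (Plin) => //.
rewrite -addrA -[x * _ - _]scale1r; apply: (Plin); first exact: Pcomm.
exact: Plin.
Qed.


(* The first-row coefficients b_j x^j of b are, up to terms in y x^(j+1), the
   commutators of y with - b_j / [j+1] x^(j+1). *)
Lemma row_antiderivative b : exists p, forall i j,
  coef p i j = if i is 0 then if j is j'.+1 then - (qnat q j)^-1 * coef b 0 j' else 0
               else 0.
Proof.
pose e i j := if i is 0 then - (qnat q j.+1)^-1 *: mon 0 j.+1 else 0 : A.
have [g gl gm] := linear_ext H e.
exists (g b); elim/(mon_ind H): b => [c v w Ev Ew | a b] i j.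
  rewrite gl (pbw_coef_lin H) Ev Ew.
  by case: i j => [|i] [|j]; rewrite /= ?(pbw_coef_lin H); ring.
rewrite gm /e; case: a => [|a].
  rewrite (pbw_coefZ H) !(pbw_coef_mon H); case: i j => [|i] [|j];
    rewrite ?mulr0 // eqxx /= eqSS.
  by rewrite (pbw_coef_mon H) eqxx /=; case: eqP => [->|] //; rewrite !mulr0.
rewrite (pbw_coef0 H); case: i j => [|i] [|j]; rewrite ?(pbw_coef_mon H) //=.
by rewrite mulr0.
Qed.

Lemma koszul_kernel a b : koszul a b = 0 -> exists c u,
  a = c *: x + (x * u - u * x) /\ b = - (c *: y) + (y * u - u * y).
Proof.
have [u au] := mod_inner_axes a.
set a' := a - _ in au; pose b' := b - (y * u - u * y) => ab0.
have E0 : koszul a' b' = 0.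
  rewrite /a' /b'; move: ab0 (koszul_inner u); rewrite /koszul_diff.
  move: (x * u - u * x) (y * u - u * y) => s t; alg_expand => E1 E2.
  by apply: lc_use (lc_add (lc_eq E1) (lc_scale (-1) (lc_eq E2))) _; lmod k A.
have a'E : a' = a - (x * u - u * x) by [].
have b'E : b' = b - (y * u - u * y) by [].
clearbody a' b'; pose al := coef a'; pose be := coef b'.
have E i j : (q ^+ j - q) * opY al i j + qnat q j.+1 * al i j.+1
    + (q ^+ i - q) * opXr be i j + qnat q i.+1 * be i.+1 j = 0.
  by rewrite -coef_koszul E0 (pbw_coef0 H).
have cancel (c d : k) : c != 0 -> c * d = 0 -> d = 0.
  by move=> c0 /eqP; rewrite mulf_eq0 (negPf c0) => /eqP.
have be2 i j : be i.+2 j = 0.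
  have [N bN] := bounds_ex H b'.
  have: (N <= i.+2 + N)%N by lia.
  elim: {2}N i j => [|n IHn] i j h; first by apply: bN; apply/orP; left; lia.
  apply: (cancel (q ^+ i.+2 - q)); first exact: expq_neq.
  have := E i.+2 j.+1; rewrite /= /al !au /be [coef b' i.+3 _]IHn; last by lia.
  by move=> F; apply: lc_use (lc_eq F) _; ring.
have al1 i : al i.+1 0 = 0.
  apply: (cancel (q ^+ 0 - q)); first exact: expq_neq.
  have := E i.+2 0; rewrite /= be2 /al au => F.
  by apply: lc_use (lc_eq F) _; ring.
have al0 j : j != 1%N -> al 0 j = 0.
  move=> j1; apply: (cancel (q ^+ j - q)); first exact: expq_neq.
  have := E 1%N j; rewrite /= be2 /al au expr1 => F.
  by apply: lc_use (lc_eq F) _; ring.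
have aE : a' = al 0 1 *: x.
  apply: (pbw_coef_inj H) => i j; rewrite (pbw_coefZ H).
  rewrite -[x]mul1r (pbw_coefXr H) /opXr; case: j => [|j].
    by rewrite mulr0; case: i => [|i]; [exact: al0 | exact: al1].
  rewrite (pbw_coef1 H); case: i => [|i]; last by rewrite mulr0; exact: au.
  by case: j => [|j]; rewrite ?mulr1 // mulr0; exact: al0.
have [p pE] := row_antiderivative b'.
exists (al 0 1), (u + p); split.
  have xp : x * p - p * x = 0.
    apply: (pbw_coef_inj H) => i j; rewrite (pbw_coefB H) (pbw_coefXl H) (pbw_coefXr H).
    rewrite (pbw_coef0 H) /opX /opXr; case: j => [|j]; rewrite !pE; first by ring.
    by case: i => [|i]; rewrite ?expr0; ring.
  apply: lc_use (lc_add (lc_eq aE) (lc_scale (-1) xp)) _.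
  by rewrite a'E; alg_expand; lmod k A.
have bE : b' = - (al 0 1 *: y) + (y * p - p * y).
  apply: (pbw_coef_inj H) => i j.
  rewrite (pbw_coefD H) (pbw_coefN H) (pbw_coefB H) (pbw_coefYl H) (pbw_coefYr H).
  rewrite (pbw_coefZ H); have -> : coef y i j = coef (mon 1 0) i j by rewrite /weyl_mon mulr1.
  rewrite (pbw_coef_mon H) /opYr /opY -/be.
  case: i => [|[|i]].
  - rewrite !pE -/be /=.
    by field; rewrite qnat_neq0.
  - rewrite !pE -/be; case: j => [|j] /=.
      by have := E 0 0; rewrite /= !qnat1 => F; apply: lc_use (lc_eq F) _; ring.
    have := E 0 j.+1; rewrite /= al0 // qnat1 expr0 => F.
    have -> : q ^+ j.+1 = 1 - (1 - q) * qnat q j.+1 by rewrite qnatE subKr.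
    by apply: lc_use (lc_eq F) _; field; rewrite qnat_neq0.
  - by rewrite be2 !pE /=; ring.
apply: lc_use (lc_eq bE) _.
by rewrite b'E; alg_expand; lmod k A.
Qed.

Lemma euler_not_inner u : x * u - u * x <> x.
Proof.
move=> xu; pose c := coef u.
have E i j : (q ^+ i - 1) * opXr c i j + qnat q i.+1 * c i.+1 j =
    ((i == 0%N) && (j == 1%N))%:R.
  rewrite -(pbw_coef_mon H 0 1) /weyl_mon mul1r expr1 -[in RHS]xu.
  by rewrite (pbw_coefB H) (pbw_coefXl H) (pbw_coefXr H) /opX -/c; ring.
have c_neq0 n : c n.+1 n.+1 != 0.
  elim: n => [|n IHn].
    have := E 0 1%N; rewrite /= subrr mul0r add0r qnat1 mul1r => ->.
    exact: oner_neq0.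
  apply: contra_neq (mulf_neq0 (expq_neq1 (ltn0Sn n)) IHn) => c0.
  by have := E n.+1 n.+2; rewrite /= c0 mulr0 addr0.
have [N uN] := bounds_ex H u.
by move/eqP: (c_neq0 N); apply; apply: uN; rewrite leqnSn.
Qed.

Lemma koszul_lin c a a' b b' :
  koszul (c *: a + a') (c *: b + b') = c *: koszul a b + koszul a' b'.
Proof. by rewrite /koszul_diff; alg_expand; lmod k A. Qed.

Lemma koszul_monl i j :
  koszul (mon i j) 0 = (q ^+ j - q) *: mon i.+1 j + qnat q j *: mon i j.-1.
Proof.
rewrite /koszul_diff (mon_mulY H) mulY_mon mul1r mulr0 mul0r.
by lmod k A.
Qed.

Lemma koszul_monr i j :
  koszul 0 (mon i j) = (q ^+ i - q) *: mon i j.+1 + qnat q i *: mon i.-1 j.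
Proof.
rewrite /koszul_diff (mulX_mon H) mon_mulX mul1r mulr0 mul0r.
by lmod k A.
Qed.

Lemma koszul_cokernel a : exists c p s, a = koszul p s + c *: (y * x).
Proof.
pose P a := exists c p s, a = koszul p s + c *: (y * x).
have Plin d v w : P v -> P w -> P (d *: v + w).
  move=> [c [p [s ->]]] [c' [p' [s' ->]]].
  exists (d * c + c'), (d *: p + p'), (d *: s + s').
  by rewrite koszul_lin; lmod k A.
have Pk p s : P (koszul p s) by exists 0, p, s; rewrite scale0r addr0.
have k00 : koszul 0 0 = 0 by rewrite /koszul_diff !mulr0 !mul0r addr0 scaler0 subr0.
have P0 : P 0 by rewrite -k00.
have Pstep (c d : k) p s u v : c != 0 ->
    koszul p s = c *: u + d *: v -> P v -> P u.
  move=> c0 E Pv.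
  have -> : u = (- (d / c)) *: v + (c^-1 *: koszul p s + 0).
    by apply: (scalerI c0); rewrite E; lmod k A; field.
  by apply: (Plin) => //; apply: (Plin).
rewrite -/(P a); elim/(mon_ind H): a => [c v w | i j]; first exact: Plin.
elim: i j => [|i IHi] j.
  have -> : mon 0 j = koszul 0 (mon 1 j); last exact: Pk.
  by rewrite koszul_monr /= expr1 subrr scale0r add0r qnat1 scale1r.
have [-> {j}|j1] := eqVneq j 1%N; last first.
  exact: Pstep (expq_neq j1) (koszul_monl i j) (IHi _).
case: i IHi => [|i] IHi; first by exists 1, 0, 0; rewrite k00 add0r scale1r.
exact: Pstep (expq_neq (n := i.+2) isT) (koszul_monr i.+2 0) (IHi _).
Qed.

Lemma koszul_trace : exists t : A -> k^o,
  [/\ semilin idfun t, forall a b, t (koszul a b) = 0 & t (y * x) = 1].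
Proof.
pose c := fix c n : k := if n is m.+1 then
  if m is 0 then 1 else - (qnat q n / (q ^+ n - q)) * c m else 0.
have [t tl tm] := linear_ext H (fun i j => (if i == j then c i else 0) : k^o).
have cS n : (q ^+ n.+1 - q) * c n.+1 + qnat q n.+1 * c n = 0.
  case: n => [|n]; first by rewrite /= expr1 subrr mul0r mulr0 addr0.
  have -> : c n.+2 = - (qnat q n.+2 / (q ^+ n.+2 - q)) * c n.+1 by [].
  by have := expq_neq (n := n.+2) isT; move: (q ^+ _) => Q Q0; field.
have t0 := semilin0 tl.
exists t; split=> // [a b|]; last by have := tm 1%N 1%N; rewrite /weyl_mon !expr1.
have tl0 a' : t (koszul a' 0) = 0.
  elim/(mon_ind H): a' => [d v w Ev Ew | i j].
    have -> : koszul (d *: v + w) 0 = d *: koszul v 0 + koszul w 0.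
      by rewrite -koszul_lin scaler0 addr0.
    by rewrite tl Ev Ew scaler0 addr0.
  rewrite koszul_monl tl (semilinZ tl) !tm /=.
  case: j => [|j]; first by rewrite qnat0 scale0r scaler0 addr0.
  rewrite eqSS /=; case: eqP => [->|_]; last by rewrite !scaler0 addr0.
  exact: cS.
have tr0 b' : t (koszul 0 b') = 0.
  elim/(mon_ind H): b' => [d v w Ev Ew | i j].
    have -> : koszul 0 (d *: v + w) = d *: koszul 0 v + koszul 0 w.
      by rewrite -koszul_lin scaler0 addr0.
    by rewrite tl Ev Ew scaler0 addr0.
  rewrite koszul_monr tl (semilinZ tl) !tm /=.
  case: i => [|i]; first by rewrite qnat0 scale0r scaler0 addr0.
  rewrite eqSS /=; case: eqP => [->|_]; last by rewrite !scaler0 addr0.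
  exact: cS.
have -> : koszul a b = 1 *: koszul a 0 + koszul 0 b.
  by rewrite -koszul_lin !scale1r addr0 add0r.
by rewrite tl tl0 tr0 scaler0 addr0.
Qed.

End WeylCohomology.

(** * Hochschild cochains of low degree *)

Section LowDegree.
Variables (R : comNzRingType) (A : algType R).

Definition args n (s : seq A) : {ffun 'I_n -> A} := [ffun j => nth 0 s (val j)].

Lemma args0 (a b : {ffun 'I_0 -> A}) : a = b.
Proof. by apply/ffunP => -[]. Qed.

Lemma args1E (a : {ffun 'I_1 -> A}) : a = args 1 [:: a ord0].
Proof. by apply/ffunP => j; rewrite ffunE (ord1 j). Qed.

Lemma args2E (a : {ffun 'I_2 -> A}) : a = args 2 [:: a ord0; a ord_max].
Proof.
apply/ffunP => -[[|[|j]] h] //; rewrite ffunE /=; congr (a _); exact: val_inj.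
Qed.

Lemma args3E (a : {ffun 'I_3 -> A}) :
  a = args 3 [:: a ord0; a (lift ord0 ord0); a ord_max].
Proof.
apply/ffunP => -[[|[|[|j]]] h] //; rewrite ffunE /=; congr (a _); exact: val_inj.
Qed.

Definition cochain2 (F : A -> A -> A) (a : {ffun 'I_2 -> A}) : A :=
  F (a ord0) (a ord_max).

Lemma cochain2K (f : {ffun 'I_2 -> A} -> A) :
  cochain2 (fun a b => f (args 2 [:: a; b])) = f.
Proof. by apply/funext => a; rewrite /cochain2 -args2E. Qed.

Lemma multilinear1 (g : {ffun 'I_1 -> A} -> A) :
  multilinear g <-> semilin idfun (fun a => g (args 1 [:: a])).
Proof.
have E (a : {ffun 'I_1 -> A}) i u : set_arg a i u = args 1 [:: u].
  by apply/ffunP => j; rewrite !ffunE (ord1 i) (ord1 j).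
split=> gl; last by move=> a i c u v; rewrite !E gl.
by move=> c u v; have := gl (args 1 [:: 0]) ord0 c u v; rewrite !E.
Qed.

Lemma multilinear2 (F : A -> A -> A) :
  multilinear (cochain2 F) <-> bilinear_cochain F.
Proof.
split=> [Fl | [fl fr] a i c u v].
  split=> a c u v.
    by have := Fl (args 2 [:: 0; a]) ord0 c u v; rewrite /cochain2 !ffunE.
  by have := Fl (args 2 [:: a; 0]) ord_max c u v; rewrite /cochain2 !ffunE.
rewrite /cochain2 !ffunE; by case: i => -[|[|i]] h //=; [exact: fl | exact: fr].
Qed.

Lemma hdiff0E (f : {ffun 'I_0 -> A} -> A) e a :
  hdiff f a = a ord0 * f e - f e * a ord0.
Proof.
have E b : f b = f e by rewrite (args0 b e).
by rewrite /hdiff big_ord0 addr0 expr1 scaleN1r !E (ord1 ord_max).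
Qed.

Lemma hdiff1E (g : {ffun 'I_1 -> A} -> A) a b :
  hdiff g (args 2 [:: a; b]) = coboundary (fun u => g (args 1 [:: u])) a b.
Proof.
have E (c : {ffun 'I_1 -> A}) u : c ord0 = u -> g c = g (args 1 [:: u]).
  by move=> <-; rewrite -args1E.
rewrite /hdiff big_ord_recl big_ord0 addr0 !ffunE /= expr1 sqrrN expr1n.
rewrite scaleN1r scale1r /coboundary; congr (_ * _ - _ + _ * _);
  by apply: E; rewrite !ffunE.
Qed.

Lemma hdiff2E (F : A -> A -> A) a b c :
  hdiff (cochain2 F) (args 3 [:: a; b; c]) =
  a * F b c - F (a * b) c + F a (b * c) - F a b * c.
Proof.
rewrite /hdiff /cochain2 !big_ord_recl big_ord0 addr0 !ffunE /=.
rewrite expr1 !exprS expr0 !mulr1 mulrNN mulr1 mulN1r.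
by rewrite !scaleN1r scale1r addrA.
Qed.

Lemma HH_lineI n (z : hcocycle A n) : ~ is_hcoboundary z ->
  (forall w : hcocycle A n, exists c, is_hcoboundary (c *: z + w)) -> HH_line z.
Proof.
move=> zb wb; exists z; split=> //; first by apply/eqP => /HH_class_eq0.
move=> h; have [c /HH_class_eq0] := wb (repr h).
rewrite HH_classP [HH_class (repr h)]reprK => E; exists (- c).
by apply/eqP; rewrite scaleNr -addr_eq0 addrC E.
Qed.

Lemma hcocycle_multilinear n (z : hcocycle A n) : multilinear z.
Proof. by case: z => f /= /asboolP[]. Qed.

Lemma hcocycle_hdiff n (z : hcocycle A n) : hdiff z = 0.
Proof. by case: z => f /= /asboolP[]. Qed.

End LowDegree.

Section MakeCocycles.
Variables (R : comNzRingType) (A : algType R).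

Lemma cochain2_hcocycle (F : A -> A -> A) : bilinear_cochain F -> cocycle2 F ->
  cochain2 F \in @is_hcocycle R A 2.
Proof.
move=> Fl Fc; apply/asboolP; split; first exact/multilinear2.
apply/funext => a; rewrite (args3E a) hdiff2E; apply/subr0_eq.
rewrite subr0; apply: lc_use (lc_scale (-1) (lc_eq (Fc _ _ _))) _.
by lmod R A.
Qed.

Lemma hcocycle2_bilinear (z : hcocycle A 2) :
  bilinear_cochain (fun a b => z (args 2 [:: a; b])).
Proof. by apply/multilinear2; rewrite cochain2K; exact: hcocycle_multilinear. Qed.

Lemma hcocycle2_cocycle (z : hcocycle A 2) :
  cocycle2 (fun a b => z (args 2 [:: a; b])).
Proof.
move=> a b c; have := congr1 (@^~ (args 3 [:: a; b; c])) (hcocycle_hdiff z).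
rewrite -{1}(cochain2K z) hdiff2E => E.
by apply: lc_use (lc_scale (-1) E) _; lmod R A.
Qed.

End MakeCocycles.

Section WeylLines.
Variables (k : fieldType) (q : k) (A : algType k) (x y : A).
Variables (coef : A -> nat -> nat -> k) (H : pbw q 1 x y coef).
Hypotheses (q0 : q != 0) (qN : forall N, (0 < N)%N -> q ^+ N != 1).
Local Notation koszul := (koszul_diff q x y).

Lemma HH0_line : HH_line (fun _ : {ffun 'I_0 -> A} => 1 : A).
Proof.
have z1 : (fun _ : {ffun 'I_0 -> A} => 1 : A) \in @is_hcocycle k A 0.
  apply/asboolP; split=> [a []//|]; apply/funext => a.
  by rewrite (hdiff0E _ (args 0 [::])) mulr1 mul1r subrr.
apply: (@HH_lineI _ _ _ (HCocycle z1)) => [/eqP/(congr1 val) /= E | w].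
  by have := congr1 (@^~ (args 0 [::])) E => /eqP; rewrite oner_eq0.
have wc a : a * w (args 0 [::]) = w (args 0 [::]) * a.
  have := congr1 (@^~ (args 1 [:: a])) (hcocycle_hdiff w).
  by rewrite (hdiff0E _ (args 0 [::])) !ffunE => /subr0_eq.
exists (- coef (w (args 0 [::])) 0 0); apply/eqP/val_inj/funext => a.
change (- coef (w (args 0 [::])) 0 0 *: 1 + w a = 0).
rewrite (args0 a (args 0 [::])) {2}(center_scalar H qN (wc x) (wc y)).
by rewrite scaleNr addNr.
Qed.

Lemma deriv_eq0 (D : A -> A) : semilin idfun D ->
  (forall u v, D (u * v) = D u * v + u * D v) -> D x = 0 -> D y = 0 ->
  forall u, D u = 0.
Proof.
move=> Dl DM Dx Dy; elim/(pbw_ind H) => [c u v Eu Ev||u Eu|u Eu].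
- by rewrite Dl Eu Ev scaler0 addr0.
- exact: deriv1.
- by rewrite DM Dx Eu mul0r mulr0 addr0.
- by rewrite DM Dy Eu mul0r mulr0 addr0.
Qed.

Lemma deriv_koszul (D : A -> A) : semilin idfun D ->
  (forall u v, D (u * v) = D u * v + u * D v) -> koszul (D x) (D y) = 0.
Proof.
move=> Dl DM; have := congr1 D (pbw_rel H).
rewrite Dl (semilinZ Dl) !DM (deriv1 DM) /= => E; rewrite /koszul_diff.
by apply: lc_use (lc_eq E) _; lmod k A.
Qed.

Lemma HH1_line (D : A -> A) : derivation D -> D x = x -> D y = - y ->
  HH_line (cochain1 D).
Proof.
move=> [Dl DM] Dx Dy.
have DE : (fun a => cochain1 D (args 1 [:: a])) = D.
  by apply/funext => a; rewrite /cochain1 ffunE.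
have z1 : cochain1 D \in @is_hcocycle k A 1.
  apply/asboolP; split; first by apply/multilinear1; rewrite DE.
  apply/funext => a; rewrite (args2E a) hdiff1E DE /coboundary DM.
  by transitivity (0 : A); first by lmod k A.
apply: (@HH_lineI _ _ _ (HCocycle z1)) => [/asboolP[g _ /= E] | w].
  apply: (euler_not_inner H qN (u := g (args 0 [::]))); rewrite -[RHS]Dx.
  by rewrite -DE E (hdiff0E _ (args 0 [::])) !ffunE.
pose D' a := w (args 1 [:: a]).
have Dl' : semilin idfun D' by apply/multilinear1; exact: hcocycle_multilinear.
have DM' u v : D' (u * v) = D' u * v + u * D' v.
  have := congr1 (@^~ (args 2 [:: u; v])) (hcocycle_hdiff w).
  rewrite hdiff1E -/D' /coboundary => E.
  by apply: lc_use (lc_scale (-1) E) _; lmod k A.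
have [c [u [ex ey]]] := koszul_kernel H q0 qN (deriv_koszul Dl' DM').
have Dc v : D' v = c *: D v + (v * u - u * v).
  apply/eqP; rewrite -subr_eq0; apply/eqP.
  apply: (deriv_eq0 (D := fun v => D' v - (c *: D v + (v * u - u * v)))).
  - by move=> d v1 v2; rewrite Dl' Dl /=; alg_expand; lmod k A.
  - by move=> v1 v2; rewrite DM' DM /=; alg_expand; lmod k A.
  - by rewrite Dx ex subrr.
  - by rewrite Dy ey scalerN subrr.
exists (- c); apply/asboolP; exists (fun=> u); first by move=> a [].
apply/funext => a; rewrite (args1E a) (hdiff0E _ (args 0 [::])) ffunE /=.
change (- c *: cochain1 D (args 1 [:: a ord0]) + D' (a ord0) =
  a ord0 * u - u * a ord0).
by rewrite Dc /cochain1 ffunE /=; lmod k A.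
Qed.

Lemma HH2_line (w : hcocycle A 2) :
  obstruction q 1 x y (fun a b => w (args 2 [:: a; b])) = q *: (y * x) ->
  HH_line w.
Proof.
move=> wo; apply: HH_lineI => [/asboolP[g gm E] | z].
  have [t [tl tk t1]] := koszul_trace H q0 qN.
  have := coboundary_obstruction H ((multilinear1 g).1 gm).
  have -> : obstruction q 1 x y (coboundary (fun a => g (args 1 [:: a]))) = q *: (y * x).
    by rewrite -wo E /obstruction !hdiff1E.
  move=> /(congr1 t); rewrite tk (semilinZ tl) t1 => /eqP.
  by rewrite scaler_eq0 (negPf q0) oner_eq0.
set fz := fun a b => z (args 2 [:: a; b]).
set fw := fun a b => w (args 2 [:: a; b]) in wo.
have [c [p [s E]]] := koszul_cokernel H q0 qN (obstruction q 1 x y fz).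
pose d := - (c / q); pose f a b := d *: fw a b + fz a b.
have [wl wr] : bilinear_cochain fw := hcocycle2_bilinear w.
have [zl zr] : bilinear_cochain fz := hcocycle2_bilinear z.
have fl : bilinear_cochain f.
  by split=> a e u v; rewrite /f ?wl ?zl ?wr ?zr /=; lmod k A.
have fc : cocycle2 f.
  move=> a b e; rewrite /f.
  have E1 : fw (a * b) e + fw a b * e = _ := hcocycle2_cocycle w a b e.
  have E2 : fz (a * b) e + fz a b * e = _ := hcocycle2_cocycle z a b e.
  alg_expand; apply: lc_use (lc_add (lc_scale d (lc_eq E1)) (lc_eq E2)) _.
  by lmod k A.
have fo : koszul (- p) (- s) + obstruction q 1 x y f = 0.
  have -> : obstruction q 1 x y f = d *: obstruction q 1 x y fw + obstruction q 1 x y fz.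
    by rewrite /obstruction /f; lmod k A.
  rewrite wo E scalerA mulNr divfK // /koszul_diff.
  by alg_expand; lmod k A.
have [g gl [_ _ gM]] := section_ext H fl fc fo.
exists d; apply/asboolP; exists (fun a => - g (a ord0)).
  by move=> a i e u v; rewrite !ffunE (ord1 i) gl /=; lmod k A.
apply/funext => a; rewrite (args2E a) hdiff1E.
change (d *: fw (a ord0) (a ord_max) + fz (a ord0) (a ord_max) =
 coboundary (fun u => - g ((args 1 [:: u]) ord0)) (a ord0) (a ord_max)).
rewrite /coboundary !ffunE /= gM -/(f _ _).
by alg_expand; lmod k A.
Qed.

End WeylLines.

(** * Lifting along the deformation *)

Section NormalOrdering.
Variables (k : fieldType) (q : k) (A : algType k) (x y : A).
Variables (coef : A -> nat -> nat -> k) (H : pbw q 0 x y coef).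
Hypothesis (q0 : q != 0).

Lemma expXY i j : x ^+ i * y ^+ j = q ^+ (i * j) *: weyl_mon x y j i.
Proof.
elim: i => [|i IHi]; first by rewrite mul0n scale1r mul1r /weyl_mon mulr1.
rewrite exprS -mulrA IHi -scalerAr (mulX_mon H) mul0r scale0r addr0 scalerA.
by rewrite -exprD mulSn addnC.
Qed.

Lemma mon_expXY i j : weyl_mon x y i j = q ^- (j * i) *: (x ^+ j * y ^+ i).
Proof. by rewrite expXY scalerA mulVf ?scale1r // expf_neq0. Qed.

Lemma normal_order_ext (S : comNzRingType) (phi : {rmorphism k -> S})
    (B : algType S) (X Y : B) :
  exists2 g : A -> B, semilin phi g
    & forall i j, g (x ^+ i * y ^+ j) = X ^+ i * Y ^+ j.
Proof.
have [g gl gm] := semilin_ext H phi (fun i j => phi (q ^- (j * i)) *: (X ^+ j * Y ^+ i)).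
exists g => // i j; rewrite expXY (semilinZ gl) gm scalerA -rmorphM divff ?expf_neq0 //.
by rewrite rmorph1 scale1r.
Qed.

Lemma eq_normal_order (S : comNzRingType) (phi : {rmorphism k -> S})
    (B : lmodType S) (g h : A -> B) : semilin phi g -> semilin phi h ->
  (forall i j, g (x ^+ i * y ^+ j) = h (x ^+ i * y ^+ j)) -> g =1 h.
Proof.
move=> gl hl gh; apply: (eq_semilin H gl hl) => i j.
by rewrite mon_expXY (semilinZ gl) (semilinZ hl) gh.
Qed.

End NormalOrdering.

Section Swap.
Variables (R : comNzRingType) (q r p s : R).
Hypotheses (qp : q * p = 1) (rs : s = - (p * r)).
Variables (A : algType R) (x y : A) (coef : A -> nat -> nat -> R).
Variables (B : algType R) (x' y' : B) (coef' : B -> nat -> nat -> R).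
Hypotheses (HA : pbw q r x y coef) (HB : pbw p s x' y' coef').

(* Exchanging the generators of A turns its basis x^i y^j into the basis
   y'^i x'^j of B. *)
Lemma swap_ext : exists2 g : A -> B, semilin idfun g
  & exists2 h : B -> A, semilin idfun h
    & cancel g h /\ forall i j, h (weyl_mon x' y' i j) = x ^+ i * y ^+ j.
Proof.
have BA : y' * x' = q *: (x' * y') + r%:A.
  rewrite (pbw_rel HB) scalerDr !scalerA qp rs mulrN mulrA qp mul1r scale1r.
  by rewrite scaleNr subrK.
have AB : y * x = p *: (x * y) + s%:A.
  rewrite (pbw_rel HA) scalerDr !scalerA [p * q]mulrC qp rs scale1r.
  by rewrite scaleNr addrK.
have [g gh [gx gy]] := semihom_ext HA (phi := idfun) BA.
have [h hh [hx hy]] := semihom_ext HB (phi := idfun) AB.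
exists g; first exact: semihom_linear gh.
exists h; first exact: semihom_linear hh.
split=> [u|i j]; last by rewrite (semihom_mon x' y' _ _ hh) hx hy.
have [[gl g1 gM] [hl h1 hM]] := (gh, hh).
elim/(pbw_ind HA): u => [c u v Eu Ev || u Eu | u Eu].
- by rewrite gl hl Eu Ev.
- by rewrite g1 h1.
- by rewrite gM hM gx hy Eu.
- by rewrite gM hM gy hx Eu.
Qed.

End Swap.

Lemma poly_coef_sum (R : nzRingType) (p : {poly R}) N : (size p <= N)%N ->
  p = \sum_(n < N) (p`_n)%:P * 'X^n.
Proof.
move=> pN; rewrite -[LHS]coefK poly_def (big_ord_widen N (fun n => p`_n *: 'X^n) pN).
rewrite big_mkcond /=; apply: eq_bigr => n _; rewrite mul_polyC.
by case: ltnP => // h; rewrite nth_default // scale0r.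
Qed.

Section Lift.
Variables (k : fieldType) (q : k) (q0 : q != 0).
Variables (A0 : algType k) (x0 y0 : A0) (coef0 : A0 -> nat -> nat -> k).
Variables (A1 : algType k) (x1 y1 : A1) (coef1 : A1 -> nat -> nat -> k).
Variables (Ah : algType {poly k}) (xh yh : Ah) (coefh : Ah -> nat -> nat -> {poly k}).
Variables (As : algType {poly k}) (xs ys : As) (coefs : As -> nat -> nat -> {poly k}).
Hypotheses (H0 : pbw q 0 x0 y0 coef0) (H1 : pbw q 1 x1 y1 coef1).
Hypotheses (Hh : pbw q%:P 'X xh yh coefh).
Hypotheses (Hs : pbw q^-1%:P (- (q^-1%:P * 'X)) xs ys coefs).

Lemma poly_coordinates (sigma : A0 -> Ah) : semilin polyC sigma ->
  (forall i j, sigma (x0 ^+ i * y0 ^+ j) = xh ^+ i * yh ^+ j) ->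
  exists2 tau : nat -> Ah -> A0,
    forall n c u v, tau n (c%:P *: u + v) = c *: tau n u + tau n v
  & forall u, exists N, (forall n, (N <= n)%N -> tau n u = 0) /\
      u = \sum_(n < N) 'X^n *: sigma (tau n u).
Proof.
move=> sl sm.
have qp : q%:P * q^-1%:P = 1 by rewrite -polyCM divff.
have [g gl [h hl [gK hm]]] := swap_ext qp erefl Hh Hs.
pose E i j := x0 ^+ i * y0 ^+ j.
pose tau n u := wlin Hs (coefp n) E (g u).
exists tau => [n c u v | u].
  rewrite /tau gl wlinD; congr (_ + _); apply: wlinZ_sub => d.
  by rewrite /= coefCM.
have [M uM] := bounds_ex Hs (g u); set c := coefs (g u) in uM.
have tauE n : tau n u = \sum_(i < M) \sum_(j < M) (c i j)`_n *: E i j.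
  by rewrite /tau (wlinE _ _ _ uM).
pose N := (\max_(i < M) \max_(j < M) size (c i j))%N.
have cN i j : (i < M)%N -> (j < M)%N -> (size (c i j) <= N)%N.
  move=> iM jM; apply: leq_trans (leq_bigmax (Ordinal iM)).
  exact: (leq_bigmax (Ordinal jM)).
exists N; split=> [n Nn|].
  rewrite tauE big1 // => i _; rewrite big1 // => j _.
  by rewrite nth_default ?scale0r // (leq_trans _ Nn) // cN.
have tE : u = \sum_(i < M) \sum_(j < M) c i j *: (xh ^+ i * yh ^+ j).
  rewrite -{1}(gK u) -{1}(wlin_id Hs (g u)) (wlinE _ _ _ uM) (semilin_sum hl).
  apply: eq_bigr => i _; rewrite (semilin_sum hl); apply: eq_bigr => j _.
  by rewrite (semilinZ hl) hm.
rewrite {1}tE; under [RHS]eq_bigr => n _.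
  rewrite tauE (semilin_sum sl) scaler_sumr.
  under eq_bigr => i _ do rewrite (semilin_sum sl) scaler_sumr.
  over.
rewrite [RHS]exchange_big /=; apply: eq_bigr => i _.
rewrite [RHS]exchange_big /=; apply: eq_bigr => j _.
rewrite {1}(poly_coef_sum (cN i j (ltn_ord i) (ltn_ord j))) scaler_suml.
by apply: eq_bigr => n _; rewrite (semilinZ sl) sm scalerA mulrC.
Qed.

Lemma wedge_lift half f0 f1 fh : half + half = 1 ->
  wedge_cocycle q x0 y0 half f0 -> wedge_cocycle q x1 y1 half f1 ->
  wedge_cocycle q%:P xh yh half%:P fh ->
  exists (sigma_h : A0 -> Ah) (sigma_1 : A0 -> A1) (tau : nat -> Ah -> A0),
  [/\ semilin polyC sigma_h
        /\ forall i j, sigma_h (x0 ^+ i * y0 ^+ j) = xh ^+ i * yh ^+ j,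
      semilin idfun sigma_1
        /\ forall i j, sigma_1 (x0 ^+ i * y0 ^+ j) = x1 ^+ i * y1 ^+ j,
      forall n c u v, tau n (c%:P *: u + v) = c *: tau n u + tau n v,
      forall a b, tau 0 (fh (sigma_h a) (sigma_h b)) = f0 a b
    & forall a b, let u := fh (sigma_h a) (sigma_h b) in
        exists N, [/\ forall n, (N <= n)%N -> tau n u = 0,
          u = \sum_(n < N) 'X^n *: sigma_h (tau n u)
        & f1 (sigma_1 a) (sigma_1 b) = \sum_(n < N) sigma_1 (tau n u)]].
Proof.
move=> half2 w0 w1 wh.
have [sh shl shm] := normal_order_ext H0 q0 polyC xh yh.
have [s1 s1l s1m] := normal_order_ext H0 q0 idfun x1 y1.
have [tau taul tauE] := poly_coordinates shl shm.
pose ev (c : k) : {rmorphism {poly k} -> k} := horner_eval c.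
have evq c : ev c q%:P = q by rewrite /= /horner_eval hornerC.
have evh c : ev c half%:P = half by rewrite /= /horner_eval hornerC.
have evX c : ev c 'X = c by rewrite /= /horner_eval hornerX.
have rel0 : x0 * y0 = ev 0 q%:P *: (y0 * x0) + (ev 0 'X)%:A.
  by rewrite evq evX; exact: pbw_rel H0.
have rel1 : x1 * y1 = ev 1 q%:P *: (y1 * x1) + (ev 1 'X)%:A.
  by rewrite evq evX; exact: pbw_rel H1.
have [e0 e0h [e0x e0y]] := semihom_ext Hh rel0.
have [e1 e1h [e1x e1y]] := semihom_ext Hh rel1.
have es0 a : e0 (sh a) = a.
  apply: (eq_normal_order H0 q0 (phi := idfun) (g := e0 \o sh) (h := id)) => //.
  - by move=> c u v /=; rewrite shl (semihom_linear e0h) [ev 0 _]hornerC.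
  - by move=> i j /=; rewrite shm (semihomM e0h) !(semihomX _ _ e0h) e0x e0y.
have es1 a : e1 (sh a) = s1 a.
  apply: (eq_normal_order H0 q0 (phi := idfun) (g := e1 \o sh)) => //.
  - by move=> c u v /=; rewrite shl (semihom_linear e1h) [ev 1 _]hornerC.
  - by move=> i j /=; rewrite shm (semihomM e1h) !(semihomX _ _ e1h) e1x e1y s1m.
have n0 a b : e0 (fh (sh a) (sh b)) = f0 a b.
  rewrite -{2}(es0 a) -{2}(es0 b).
  have w0' : wedge_cocycle q x0 y0 (ev 0 half%:P) f0 by rewrite evh.
  exact: (wedge_cocycle_natural Hh e0h e0x e0y (evq 0) wh w0').
have n1 a b : e1 (fh (sh a) (sh b)) = f1 (s1 a) (s1 b).
  rewrite -(es1 a) -(es1 b).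
  have w1' : wedge_cocycle q x1 y1 (ev 1 half%:P) f1 by rewrite evh.
  exact: (wedge_cocycle_natural Hh e1h e1x e1y (evq 1) wh w1').
exists sh, s1, tau; split=> // [a b | a b u].
  rewrite -n0; set u := fh _ _.
  have [[|N] [tN uE]] := tauE u.
    by rewrite tN // {1}uE big_ord0 (semilin0 e0h).
  rewrite {2}uE (semilin_sum e0h) big_ord_recl big1 => [|i _].
    by rewrite (semilinZ e0h) es0 expr0 rmorph1 scale1r addr0.
  by rewrite (semilinZ e0h) exprS rmorphM evX mul0r scale0r.
have [N [tN uE]] := tauE u; exists N; split=> //.
rewrite -n1 -/u {1}uE (semilin_sum e1h); apply: eq_bigr => i _.
by rewrite (semilinZ e1h) es1 rmorphXn evX expr1n scale1r.
Qed.

End Lift.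

Lemma derivation_ext (k : fieldType) (q r : k) (A : algType k) (x y : A)
    (coef : A -> nat -> nat -> k) (p s : A) :
  pbw q r x y coef -> koszul_diff q x y p s = 0 ->
  exists2 D : A -> A, derivation D & D x = p /\ D y = s.
Proof.
move=> H ps; pose f (a b : A) : A := 0.
have fl : bilinear_cochain f by split=> a c u v; rewrite scaler0 addr0.
have fc : cocycle2 f by move=> a b c; rewrite mulr0 mul0r.
have fo : koszul_diff q x y p s + obstruction q r x y f = 0.
  by rewrite ps /obstruction !scaler0 subr0 !addr0.
have [D Dl [Dx Dy DM]] := section_ext H fl fc fo.
by exists D => //; split=> // u v; rewrite DM addr0 addrC.
Qed.

Lemma koszul_euler (R : comNzRingType) (A : algType R) (q : R) (x y : A) :
  koszul_diff q x y x (- y) = 0.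
Proof. by rewrite /koszul_diff mulrN mulNr subrr addNr scaler0 subrr. Qed.

Lemma koszul_plane (R : comNzRingType) (A : algType R) (q : R) (x y : A)
    (coef : A -> nat -> nat -> R) : pbw q 0 x y coef ->
  koszul_diff q x y x 0 = 0 /\ koszul_diff q x y 0 y = 0.
Proof.
move=> H; have xy : x * y = q *: (y * x) by rewrite (pbw_rel H) scale0r addr0.
by rewrite /koszul_diff !mulr0 !mul0r !add0r !addr0 xy subrr.
Qed.

Lemma cochain2_obstruction (R : comNzRingType) (A : algType R) (q r : R) (x y : A)
    (f : A -> A -> A) :
  obstruction q r x y (fun a b => cochain2 f (args 2 [:: a; b])) =
  obstruction q r x y f.
Proof. by rewrite /obstruction /cochain2 !ffunE. Qed.

Lemma lift_bilinear (k : fieldType) (A : algType k) (B : algType {poly k})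
    (f : B -> B -> B) (sigma : A -> B) (tau : B -> A) :
  bilinear_cochain f -> semilin polyC sigma ->
  (forall c u v, tau (c%:P *: u + v) = c *: tau u + tau v) ->
  bilinear_cochain (fun a b => tau (f (sigma a) (sigma b))).
Proof.
by move=> [fl fr] sl tl; split=> b c u v; rewrite sl ?fl ?fr tl.
Qed.

Lemma cochain2_map (R : comNzRingType) (A : algType R) (T : Type) (s : T -> A)
    (F : A -> A -> A) (a : {ffun 'I_2 -> T}) :
  cochain2 F [ffun j => s (a j)] = F (s (a ord0)) (s (a ord_max)).
Proof. by rewrite /cochain2 !ffunE. Qed.

Lemma lift_transfer (k : fieldType) (q : k)
    (z : hcocycle (weyl q 0) 2) (w : hcocycle (weyl q 1) 2)
    (z_h : hcocycle (weyl (q%:P : {poly k}) 'X) 2) f1 fh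
    (sigma_h : weyl q 0 -> weyl (q%:P : {poly k}) 'X)
    (sigma_1 : weyl q 0 -> weyl q 1)
    (tau : nat -> weyl (q%:P : {poly k}) 'X -> weyl q 0) :
  hcocycle_val w = cochain2 f1 -> hcocycle_val z_h = cochain2 fh ->
  semilin polyC sigma_h ->
  normal_ordering polyC sigma_h -> normal_ordering id sigma_1 ->
  (forall n c u v, tau n (c%:P *: u + v) = c *: tau n u + tau n v) ->
  (forall a : {ffun 'I_2 -> weyl q 0},
    tau 0 (fh (sigma_h (a ord0)) (sigma_h (a ord_max))) = z a) ->
  (forall a b, let u := fh (sigma_h a) (sigma_h b) in
    exists N, [/\ forall n, (N <= n)%N -> tau n u = 0,
      u = \sum_(n < N) 'X^n *: sigma_h (tau n u)
    & f1 (sigma_1 a) (sigma_1 b) = \sum_(n < N) sigma_1 (tau n u)]) ->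
  is_lift z w.
Proof.
move=> wE zhE shl sh s1 taul tau0 tauN.
exists sigma_h, sigma_1,
  (fun n a => tau n (fh (sigma_h (a ord0)) (sigma_h (a ord_max)))), z_h.
have fhl : bilinear_cochain fh.
  by apply/multilinear2; rewrite -zhE; exact: hcocycle_multilinear.
split=> // [n|| a].
- apply/(@multilinear2 k (weyl q 0) (fun a b => tau n (fh (sigma_h a) (sigma_h b)))).
  exact: lift_bilinear fhl shl (taul n).
- exact/funext.
have [N [tN uE wN]] := tauN (a ord0) (a ord_max).
exists N; split; first exact: tN.
- by rewrite zhE; apply: etrans uE; exact: cochain2_map.
- by rewrite wE; apply: etrans wN; exact: cochain2_map.
Qed.

Theorem theorem10 (k : fieldType) (q : k)
    (char0 : [pchar k] =i pred0) (q_neq0 : q != 0)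
    (q_not_root : forall N : nat, (0 < N)%N -> q ^+ N != 1) :
  [/\ HH_line (fun _ : {ffun 'I_0 -> weyl q 1} => 1),
      exists D : weyl q 1 -> weyl q 1,
        [/\ derivation D,
            D (weyl_x q 1) = weyl_x q 1,
            D (weyl_y q 1) = - weyl_y q 1
          & HH_line (cochain1 D)]
    & exists (Dx Dy : weyl q 0 -> weyl q 0)
             (z : hcocycle (weyl q 0) 2) (w : hcocycle (weyl q 1) 2),
        [/\ derivation Dx /\ Dx (weyl_x q 0) = weyl_x q 0 /\
              Dx (weyl_y q 0) = 0,
            derivation Dy /\ Dy (weyl_x q 0) = 0 /\
              Dy (weyl_y q 0) = weyl_y q 0,
            hcocycle_val z = wedge Dx Dy,
            is_lift z w
          & HH_line w]].
Proof.
have H0 := weyl_pbw q 0; have H1 := weyl_pbw q 1.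
have Hh := weyl_pbw q%:P ('X : {poly k}).
have Hs := weyl_pbw q^-1%:P (- (q^-1%:P * 'X : {poly k})).
split; first exact: (HH0_line H1 q_not_root).
  have [D DD [Dx Dy]] : exists2 D : weyl q 1 -> weyl q 1, derivation D
      & D (weyl_x q 1) = weyl_x q 1 /\ D (weyl_y q 1) = - weyl_y q 1.
    exact: (derivation_ext H1 (koszul_euler _ _ _)).
  exists D; split; [exact: DD | exact: Dx | exact: Dy |].
  exact: (HH1_line H1 q_neq0 q_not_root DD Dx Dy).
have [Dx [Dxl DxM] [Dxx Dxy]] : exists2 D : weyl q 0 -> weyl q 0, derivation D
    & D (weyl_x q 0) = weyl_x q 0 /\ D (weyl_y q 0) = 0.
  exact: (derivation_ext H0 (koszul_plane H0).1).
have [Dy [Dyl DyM] [Dyx Dyy]] : exists2 D : weyl q 0 -> weyl q 0, derivation D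
    & D (weyl_x q 0) = 0 /\ D (weyl_y q 0) = weyl_y q 0.
  exact: (derivation_ext H0 (koszul_plane H0).2).
have two0 : 2%:R != 0 :> k.
  by have := char0 2; rewrite !inE /= => /negbT.
have half2 : 2%:R^-1 + 2%:R^-1 = 1 :> k by rewrite -mulr2n -[LHS]mulr_natl divff.
have [f0 w0] := wedge_cocycle_ex H0 2%:R^-1.
have [f1 w1] := wedge_cocycle_ex H1 2%:R^-1.
have [fh wh] := wedge_cocycle_ex Hh (2%:R^-1)%:P.
have z0 := cochain2_hcocycle (wedge_cocycle_bilinear w0) (wedge_cocycle_cocycle H0 w0).
have z1 := cochain2_hcocycle (wedge_cocycle_bilinear w1) (wedge_cocycle_cocycle H1 w1).
have zh := cochain2_hcocycle (wedge_cocycle_bilinear wh) (wedge_cocycle_cocycle Hh wh).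
exists Dx, Dy, (HCocycle z0), (HCocycle z1); split.
- by split; [split | split; [exact: Dxx | exact: Dxy]].
- by split; [split | split; [exact: Dyx | exact: Dyy]].
- apply/funext => a.
  exact: (wedge_cocycle_plane H0 Dxl Dyl DxM DyM Dxx Dxy Dyx Dyy half2 w0).
- have [sh [s1 [tau [[shl shm] [s1l s1m] taul tau0 tauN]]]] :=
    wedge_lift q_neq0 H0 H1 Hh Hs half2 w0 w1 wh.
  refine (@lift_transfer k q (HCocycle z0) (HCocycle z1) (HCocycle zh) f1 fh
    sh s1 tau erefl erefl shl _ _ taul _ tauN).
  + by split; [exact: semilinD shl | exact: semilinZ shl | exact: shm].
  + by split; [exact: semilinD s1l | exact: semilinZ s1l | exact: s1m].
  + by move=> a; exact: tau0.
- apply: (HH2_line H1 q_neq0 q_not_root).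
  rewrite -(wedge_cocycle_obstruction H1 w1).
  exact: cochain2_obstruction.
Qed.
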